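(* Let $r\in\{2,3\}$, let $A\in Mat_n(\mathcal A_r)$, let $(\mathfrak h,\Upsilon,\Upsilon^\vee)$ be its realization and let $\eta(A)$ be the auxiliary algebra over $\mathcal A_r$ with generators $e_j,f_j$ ($j=1,\dots,n$), $\mathfrak h$, and with subalgebras $\eta_+,\eta_-$ generated by $e_1,\dots,e_n$ and $f_1,\dots,f_n$ respectively. Then (1) $\eta(A)=\eta_-\oplus\mathfrak h\oplus\eta_+$ is the direct sum of vector spaces over $\mathcal A_r$; (2) $\eta_+$ and $\eta_-$ are freely generated by $e_1,\dots,e_n$ and $f_1,\dots,f_n$ correspondingly; (3) the mapping $e_j\mapsto -f_j$, $f_j\mapsto -e_j$ ($j=1,\dots,n$), $h\mapsto -h$ ($h\in\mathfrak h$) has a unique extension up to an involution $\omega$ of the algebra $\eta(A)$; (4) there exists the decomposition into root spaces relative to $\mathfrak h$ of the form $\eta(A)=\bigl(\bigoplus_{\beta\in Q_+,\beta\ne0}\eta_{-\beta}\bigr)\oplus\mathfrak h\oplus\bigl(\bigoplus_{\beta\in Q_+,\beta\neq0}\eta_\beta\bigr)$, where $\eta_\beta=\{x\in\eta(A):[h,x]=\beta(h)x\ \forall h\in\mathfrak h\}$; moreover $\dim_{\mathcal A_r}\eta_\beta<\infty$ and $\eta_\beta\subset\eta_\pm$ for $\pm\beta\in Q_+$, $\beta\neq0$; (5) among the ideals of $\eta(A)$ having trivial intersection with $\mathfrak h$ a maximal ideal $\tau$ exists, and $\tau=(\tau\cap\eta_-)\oplus(\tau\cap\eta_+)$ is the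 direct sum of ideals.
   Context: $\mathcal A_r$ is the Cayley–Dickson algebra over $\mathbf R$ with standard generators $i_0=1,i_1,\dots,i_{2^r-1}$, $i_j^2=-1$, $i_ji_k=-i_ki_j$ for $1\le j\neq k$ ($\mathcal A_2=\mathbf H$ quaternions, $\mathcal A_3=\mathbf O$ octonions). A vector space over $\mathcal A_r$ is $V={}_0Vi_0\oplus\dots\oplus{}_{2^r-1}Vi_{2^r-1}$ with pairwise isomorphic real vector spaces ${}_jV$; elements ${}_jx\,i_j$ are pure states. An $\mathbf R$-linear map $B$ is left $\mathcal A_r$-linear if $B(z\,{}_0x)=zB({}_0x)$ for ${}_0x\in{}_0V$, $z\in\mathcal A_r$; $\mathfrak h^*_l$ denotes all left $\mathcal A_r$-linear functionals $\mathfrak h\to\mathcal A_r$. A Lie (super-)algebra over $\mathcal A_r$ is $\mathfrak g=\bigoplus_k{}_k\mathfrak g\,i_k$ with pairwise isomorphic real Lie algebras ${}_k\mathfrak g$ and an $\mathbf R$-bilinear bracket such that on pure states $[xi_k,yi_j]=(-1)^{\chi(k,j)+1}[yi_j,xi_k]$ and $[xi_k,[yi_j,zi_s]]+(-1)^{\xi(k,j,s)}[yi_j,[zi_s,xi_k]]+(-1)^{\xi(k,j,s)+\xi(j,s,k)}[zi_s,[xi_k,yi_j]]=0$, where $\chi(k,j)=0$ if $k=0$ or $j=0$ or $k=j$ and $\chi(k,j)=1$ otherwise, and $\xi(k,j,s)\in\{0,1\}$ is defined by $i_k(i_ji_s)=(-1)^{\xi(k,j,s)}i_j(i_si_k)$.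 Vectors $v_1,\dots,v_m$ are vector independent over $\mathcal A_r$ if for all nonzero $a_j,b_j\in\mathcal A_r$ and all bracketings of the products, $a_1v_1b_1+\dots+a_mv_mb_m\neq0$. A realization of $A=(a_{k,j})\in Mat_n(\mathcal A_r)$ is a triple $(\mathfrak h,\Upsilon,\Upsilon^\vee)$, $\mathfrak h$ an $\mathcal A_r$-vector space, $\Upsilon=\{\beta_1,\dots,\beta_n\}\subset\mathfrak h_l^*$, $\Upsilon^\vee=\{\gamma_1,\dots,\gamma_n\}\subset\mathfrak h$, such that $\Upsilon,\Upsilon^\vee$ are vector independent; $\langle\gamma_k,\beta_j\rangle=a_{k,j}$; $n-l=\dim_{\mathcal A_r}\mathfrak h-n$ where $l$ is the rank of $A$ by rows; where $\langle a,b\rangle:=b(a)$ for $a\in\mathfrak h$, $b\in\mathfrak h_l^*$, $\langle{}_0y,\beta_j\rangle\in\mathbf R$ for ${}_0y\in{}_0\mathfrak h$, and $\langle{}_sy\,i_s,{}_k\beta\,i_k\rangle=(-1)^{\chi(s,k)}\langle{}_k\beta\,i_k,{}_sy\,i_s\rangle$ on pure states. The algebra $\eta(A)$ over $\mathcal A_r$ has generators $e_j,f_j\in{}_0\eta(A)$ and $h\in\mathfrak h$ and defining relations $[e_k,f_j]=\delta_{k,j}\gamma_j$; $[h,h']=0$; $[h,e_j]=\langle\beta_j,h\rangle e_j$; $[h,f_j]=-\langle\beta_j,h\rangle f_j$ ($h,h'\in\mathfrak h$); $[au,bv]=(ab)[u,v]=[u,v](ab)$ for $a,b\in\mathcal A_r$,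 $u,v\in{}_0\eta(A)$. $Q=\sum_j\mathbf Z\beta_j$ and $Q_+$ is the set of combinations of $\beta_1,\dots,\beta_n$ with nonnegative integer coefficients.
   Formalization: It is also assumed that each γ_j lies in ₀𝔥 (so the entries of A are real), since otherwise 𝔥 does not embed in η(A) and (1) fails; vector independence is required of every nonempty subfamily, since otherwise β_1=0 would be allowed and (4) would fail. *)

(* Defs.v *)
From HB Require Import structures.
From mathcomp Require Import all_boot all_order all_algebra.
From mathcomp Require Import all_classical all_reals.

Set Implicit Arguments.
Unset Strict Implicit.
Unset Printing Implicit Defensive.
Import Order.TTheory GRing.Theory Num.Theory.
Local Open Scope classical_set_scope.
Local Open Scope ring_scope.

(* [cd_tab r j k = (s, l)] encodes [i_j i_k = (-1)^s i_l] in the Cayley-Dickson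
   algebra with 2^r generators.  It is the doubling formula
     (a + b l)(c + d l) = (a c - conj(d) b) + (d a + b conj(c)) l
   on generators, where i_(2^r + j) = i_j l and conj(i_k) = - i_k for k != 0. *)
Fixpoint cd_tab (r j k : nat) {struct r} : bool * nat :=
  if r is r'.+1 then
    let m := (2 ^ r')%N in
    match (j < m)%N, (k < m)%N with
    | true, true => cd_tab r' j k
    | true, false => let t := cd_tab r' (k - m) j in (t.1, (m + t.2)%N)
    | false, true =>
        let t := cd_tab r' (j - m) k in (t.1 (+) (k != 0)%N, (m + t.2)%N)
    | false, false =>
        let t := cd_tab r' (k - m) (j - m) in (~~ (t.1 (+) (k - m != 0)%N), t.2)
    end
  else (false, 0%N).

Definition cd_sgn r j k := (cd_tab r j k).1.
Definition cd_idx r j k := (cd_tab r j k).2.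

Definition chi (k j : nat) : bool := [&& k != 0, j != 0 & k != j]%N.

(* sign of i_k (i_j i_s) with respect to the generator it is proportional to *)
Definition cd_sgn3 r k j s : bool :=
  cd_sgn r j s (+) cd_sgn r k (cd_idx r j s).

(* i_k (i_j i_s) = (-1)^(xi k j s) i_j (i_s i_k) *)
Definition xi r k j s : bool := cd_sgn3 r k j s (+) cd_sgn3 r j s k.

(* The A_r-vector space V = _0V i_0 (+) ... (+) _(2^r-1)V i_(2^r-1); all the
   summands _kV are identified with the real vector space V, and x stands for
   the sum of the pure states (x k) i_k.  A_r itself is the case V = R. *)
Notation AV r V := {ffun 'I_(2 ^ r) -> V}.
Notation CD r R := (AV r (R^o)%type).

Section CayleyDicksonSpaces.
Variables (R : realType) (r : nat).
Implicit Types (V W : lmodType R) (a b : CD r R).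

Definition lact V a (x : AV r V) : AV r V :=
  [ffun l : 'I_(2 ^ r) =>
    \sum_(j < 2 ^ r) \sum_(k < 2 ^ r | cd_idx r j k == l)
      (-1) ^+ cd_sgn r j k *: (a j *: x k)].

Definition ract V (x : AV r V) a : AV r V :=
  [ffun l : 'I_(2 ^ r) =>
    \sum_(k < 2 ^ r) \sum_(j < 2 ^ r | cd_idx r k j == l)
      (-1) ^+ cd_sgn r k j *: (a j *: x k)].

Definition cdmul a b : CD r R := lact a b.

Definition pure V (k : 'I_(2 ^ r)) (v : V) : AV r V :=
  [ffun j => if j == k then v else 0].

Definition real0 V (v : V) : AV r V :=
  [ffun j : 'I_(2 ^ r) => if (j == 0 :> nat)%N then v else 0].

Definition zero_part V : set (AV r V) := [set x | exists v : V, x = real0 v].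

Definition cdgen (k : 'I_(2 ^ r)) : CD r R := pure k (1 : R^o).

Definition AVsub V (P : set (AV r V)) : Prop :=
  [/\ P 0,
      forall x y, P x -> P y -> P (x + y),
      forall a x, P x -> P (lact a x)
    & forall a x, P x -> P (ract x a)].

Definition AVhom V W (P : set (AV r V)) (phi : AV r V -> AV r W) : Prop :=
  [/\ forall x y, P x -> P y -> phi (x + y) = phi x + phi y,
      forall (t : R) x, P x -> phi (t *: x) = t *: phi x,
      forall a x, P x -> phi (lact a x) = lact a (phi x)
    & forall a x, P x -> phi (ract x a) = ract (phi x) a].

Definition fin_dimA V (P : set (AV r V)) : Prop :=
  AVsub P /\
  exists (m : nat) (v : 'I_m -> AV r V), (forall i, P (v i)) /\
    forall x, P x -> exists a : 'I_m -> CD r R, x = \sum_(i < m) lact (a i) (v i).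

(* Vector independence of the family (v j), j in J, in a group M with left and
   right multiplications by A_r.  The coefficients of a combination are nonzero
   on the subfamily K of the vectors that occur in it; the bracketing c may be
   chosen separately in each term. *)
Definition vec_indep (M : zmodType) (lm : CD r R -> M -> M)
    (rm : M -> CD r R -> M) (n : nat) (J : {set 'I_n}) (v : 'I_n -> M) : Prop :=
  forall K : {set 'I_n}, K != finset.set0 -> K \subset J ->
  forall a b : 'I_n -> CD r R,
    (forall j, j \in K -> a j != 0 /\ b j != 0) ->
  forall c : 'I_n -> bool,
    \sum_(j in K) (if c j then rm (lm (a j) (v j)) (b j)
                   else lm (a j) (rm (v j) (b j))) != 0.

Definition row_rank n (A : 'M[CD r R]_n) : nat :=
  (\max_(J : {set 'I_n} |
     `[< vec_indep (fun a (v : 'rV[CD r R]_n) => map_mx (cdmul a) v)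
                   (fun (v : 'rV[CD r R]_n) a => map_mx (cdmul^~ a) v)
                   J (fun k => row k A) >]) #|J|)%N.

Definition left_linear V (b : AV r V -> CD r R) : Prop :=
  (forall (t : R) x y, b (t *: x + y) = t *: b x + b y) /\
  (forall z v, b (lact z (real0 v)) = cdmul z (b (real0 v))).

(* The left A_r-linear extension of a map on _0V.  A left A_r-linear functional
   is determined on _0V, where it is a sum of pure states (_kb) i_k with _kb
   real valued; a b and b a are taken in this A_r-vector space of functionals. *)
Definition lin_ext V (g : V -> CD r R) : AV r V -> CD r R :=
  fun x => \sum_(s < 2 ^ r) cdmul (cdgen s) (g (x s)).
Definition dual_lact V a (b : AV r V -> CD r R) : AV r V -> CD r R :=
  lin_ext (fun v => cdmul a (b (real0 v))).
Definition dual_ract V (b : AV r V -> CD r R) a : AV r V -> CD r R :=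
  lin_ext (fun v => cdmul (b (real0 v)) a).

(* <y, b> = b(y), and <b, y> is its counterpart in the reversed order, given on
   pure states by <_kb i_k, _sy i_s> = (-1)^(chi s k) <_sy i_s, _kb i_k>. *)
Definition pairing V (y : AV r V) (b : AV r V -> CD r R) : CD r R := b y.
Definition pairing_rev V (b : AV r V -> CD r R) (y : AV r V) : CD r R :=
  \sum_(k < 2 ^ r) \sum_(s < 2 ^ r)
    (-1) ^+ chi s k *:
      pairing (pure s (y s)) (lin_ext (fun v => pure k (b (real0 v) k))).

(* A realization of A on h = (+)_k h0 i_k; dim_(A_r) h = dim_R h0. *)
Record realization n (A : 'M[CD r R]_n) (h0 : vectType R)
    (beta : 'I_n -> AV r h0 -> CD r R) (gamma : 'I_n -> AV r h0) : Prop :=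
  Realization {
    rz_dual : forall j, left_linear (beta j);
    rz_real : forall j v, zero_part (pairing (real0 v) (beta j));
    rz_beta_indep : vec_indep (@dual_lact h0) (@dual_ract h0) [set: 'I_n]%SET beta;
    rz_gamma_indep : vec_indep (@lact h0) (@ract h0) [set: 'I_n]%SET gamma;
    rz_matrix : forall k j, pairing (gamma k) (beta j) = A k j;
    rz_dim : n%:Z - (row_rank A)%:Z = (\dim {:h0})%:Z - n%:Z
  }.

Record lieA_axiom V (br : AV r V -> AV r V -> AV r V) : Prop := LieAxiom {
  la_linl : forall (t : R) x y z, br (t *: x + y) z = t *: br x z + br y z;
  la_linr : forall (t : R) x y z, br z (t *: x + y) = t *: br z x + br z y;
  la_zero : forall u v, zero_part (br (real0 u) (real0 v));
  la_anti : forall k j u v,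
    br (pure k u) (pure j v) = (-1) ^+ (chi k j).+1 *: br (pure j v) (pure k u);
  la_jacobi : forall k j s u v w,
    br (pure k u) (br (pure j v) (pure s w))
    + (-1) ^+ xi r k j s *: br (pure j v) (br (pure s w) (pure k u))
    + (-1) ^+ (xi r k j s + xi r j s k) *:
        br (pure s w) (br (pure k u) (pure j v)) = 0
}.

End CayleyDicksonSpaces.

(* Lie superalgebras over A_r.  Each _kg is a copy of the real Lie algebra _0g;
   the bracket of _kg i_k with itself need not stay in _kg i_k. *)
Record lieA (R : realType) (r : nat) := LieA {
  lie0 :> lmodType R;
  lbr : AV r lie0 -> AV r lie0 -> AV r lie0;
  lieA_prf : lieA_axiom lbr
}.

Section LieAlgebras.
Variables (R : realType) (r : nat).
Implicit Types (g k : lieA R r).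

Definition scalar_compat g : Prop :=
  forall (a b : CD r R) (u v : g),
    lbr (lact a (real0 r u)) (lact b (real0 r v))
      = lact (cdmul a b) (lbr (real0 r u) (real0 r v)) /\
    lact (cdmul a b) (lbr (real0 r u) (real0 r v))
      = ract (lbr (real0 r u) (real0 r v)) (cdmul a b).

Definition lie_sub g (P : set (AV r g)) : Prop :=
  AVsub P /\ forall x y, P x -> P y -> P (lbr x y).

Definition lie_ideal g (P : set (AV r g)) : Prop :=
  AVsub P /\ forall x y, P y -> P (lbr x y) /\ P (lbr y x).

Definition lie_gen g (S : set (AV r g)) : set (AV r g) :=
  [set x | forall P, lie_sub P -> S `<=` P -> P x].

Definition lie_hom_on g k (P : set (AV r g)) (phi : AV r g -> AV r k) : Prop :=
  AVhom P phi /\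
  forall x y, P x -> P y -> phi (lbr x y) = lbr (phi x) (phi y).

Definition lie_hom g k (phi : AV r g -> AV r k) : Prop := lie_hom_on setT phi.

(* Freeness refers to the Lie superalgebras over A_r in which
   [a u, b v] = (a b) [u, v] = [u, v] (a b), with generators going to _0k. *)
Definition freely_generated g n (P : set (AV r g)) (x : 'I_n -> AV r g) : Prop :=
  P = lie_gen (range x) /\
  forall k, scalar_compat k ->
  forall y : 'I_n -> AV r k, (forall j, zero_part (y j)) ->
  exists phi : AV r g -> AV r k,
    [/\ lie_hom_on P phi,
        forall j, phi (x j) = y j
      & forall psi : AV r g -> AV r k,
          lie_hom_on P psi -> (forall j, psi (x j) = y j) ->
          forall z, P z -> psi z = phi z].

Section Eta.
Variables (n : nat) (h0 : vectType R).
Variables (beta : 'I_n -> AV r h0 -> CD r R) (gamma : 'I_n -> AV r h0).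

Record eta_rel g (e f : 'I_n -> AV r g) (iota : AV r h0 -> AV r g) : Prop :=
  EtaRel {
    er_scal : scalar_compat g;
    er_e0 : forall j, zero_part (e j);
    er_f0 : forall j, zero_part (f j);
    er_h : AVhom setT iota;
    er_ef : forall i j, lbr (e i) (f j) = if i == j then iota (gamma j) else 0;
    er_hh : forall h h', lbr (iota h) (iota h') = 0;
    er_he : forall h j,
      lbr (iota h) (e j) = lact (pairing_rev (beta j) h) (e j);
    er_hf : forall h j,
      lbr (iota h) (f j) = - lact (pairing_rev (beta j) h) (f j)
  }.

(* eta(A), the algebra given by these generators and defining relations, as the
   universal solution.  The injectivity of iota is not part of the definition. *)
Definition is_eta g (e f : 'I_n -> AV r g) (iota : AV r h0 -> AV r g) : Prop :=
  eta_rel e f iota /\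
  forall k (e' f' : 'I_n -> AV r k) (iota' : AV r h0 -> AV r k),
    eta_rel e' f' iota' ->
    exists! phi : AV r g -> AV r k,
      [/\ lie_hom phi, forall j, phi (e j) = e' j,
          forall j, phi (f j) = f' j & forall h, phi (iota h) = iota' h].

Definition Qplus : set (AV r h0 -> CD r R) :=
  [set b | exists c : 'I_n -> nat, b = \sum_(j < n) beta j *+ c j].

Definition root_space g (iota : AV r h0 -> AV r g) (b : AV r h0 -> CD r R) :
    set (AV r g) :=
  [set x | forall h, lbr (iota h) x = lact (b h) x].

End Eta.
End LieAlgebras.

(* Main.v *)
(* For r = 2, 3 the projection of x to the span of 1 and i_k is (x - i_k (x i_k)) / 2,
   so sub-bimodules and bimodule maps over A_r are determined by their real parts,
   and scalar compatibility makes eta the tensor product of A_r with a real Lie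
   algebra L having the same presentation.

   Kac's argument then applies to L.  The triangular decomposition is spanned by a
   normalizer argument.  Directness and freeness come from a coinduced module, the
   functions from words to a space N: any module N over the free Lie algebra on the
   f_j embeds in it, for every choice of the weight of the vacuum.  Given a Lie
   algebra K and elements y_j, take N = K[[t, 1/t]] + R D with D = t d/dt and f_j acting
   as [y_j t, -].  A Lie polynomial z in the f_j sends D to - t Z'(t), where Z(t) is
   its value at the y_j t, so z determines Z(1); this gives the map f_j -> y_j, and
   no Poincare-Birkhoff-Witt theorem is needed.

   Since the beta_j are linearly independent, eta_- and eta_+ consist of weight
   vectors of negative and positive weights, and an ad(h)-stable subspace contains
   the weight components of its elements.  Hence an ideal meeting h trivially is the
   sum of its intersections with eta_- and eta_+, which are again ideals, and the sum
   of all ideals contained in eta_- or in eta_+ is the largest such ideal. *)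

Require Import Defs.
From HB Require Import structures.
From mathcomp Require Import all_boot all_order all_algebra.
From mathcomp Require Import all_classical all_reals.
Import Order.TTheory GRing.Theory Num.Theory.
Local Open Scope classical_set_scope.
Local Open Scope ring_scope.

Set Implicit Arguments.
Unset Strict Implicit.
Unset Printing Implicit Defensive.

(** The obstacle to proving freeness without a basis of the enveloping algebra is the centre of the
    test algebra [K]: its adjoint action on itself loses central elements. The derivation [D]
    repairs this, because [[v t^d, D] = - d v t^d] vanishes only for [v = 0] once [d] is positive.

    The same construction with [K = L] and [y_j = f_j] shows that an element of [eta_-] is
    determined by its action on the word module, which is what directness of the triangular
    decomposition requires; freeness and directness thus rest on one module. Functions on words are
    used rather than words themselves because an arbitrary coefficient module has to embed, while
    the [e_j] must act before anything is known about [eta_-].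

    The statements for [eta_+] are not proved again: exchanging [e_j] with [- f_j] and [h] with
    [- h] gives another presentation of the same algebra. *)

Local Notation real0 := Defs.real0.

(** * The sign table of the Cayley-Dickson generators for r = 2, 3 *)

Section CayleyDicksonTable.

(** A finite test that evaluation settles. The clause guarded by [k == 0] gives the sign of
    [i_k (i_j i_k)]: this is [- i_j] for [j = 0] and [j = k], and [i_j] otherwise. *)
Definition cd_check (r : nat) : bool :=
  let I := iota 0 (2 ^ r) in
  all (fun k => [&& cd_idx r 0 k == k, ~~ cd_sgn r 0 k & ~~ cd_sgn r k 0]) I &&
  all (fun k => all (fun j =>
    [&& (cd_idx r k j < 2 ^ r)%N, cd_idx r k j == cd_idx r j k,
        cd_sgn r k j == cd_sgn r j k (+) chi k j,
        (k == 0)%N || (cd_sgn r k (cd_idx r k j) (+) cd_sgn r j k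
                        == ((j == 0) || (j == k)))%N
      & all (fun s => cd_idx r k (cd_idx r j s) == cd_idx r (cd_idx r k j) s) I])
    I) I.

Variables (r : nat) (hr : r = 2%N \/ r = 3%N).

Lemma cd_check_true : cd_check r.
Proof. by case: hr => ->; vm_compute. Qed.

Lemma mem_iota_ord (k : 'I_(2 ^ r)) : (k : nat) \in iota 0 (2 ^ r).
Proof. by rewrite mem_iota /= add0n. Qed.

Lemma cd_idx0k (k : 'I_(2 ^ r)) : cd_idx r 0 k = k.
Proof.
have /andP[/allP H _] := cd_check_true.
by have /and3P[/eqP] := H _ (mem_iota_ord k).
Qed.

Lemma cd_sgn0k (k : 'I_(2 ^ r)) : cd_sgn r 0 k = false.
Proof.
have /andP[/allP H _] := cd_check_true.
by have /and3P[_ /negbTE] := H _ (mem_iota_ord k).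
Qed.

Lemma cd_sgnk0 (k : 'I_(2 ^ r)) : cd_sgn r k 0 = false.
Proof.
have /andP[/allP H _] := cd_check_true.
by have /and3P[_ _ /negbTE] := H _ (mem_iota_ord k).
Qed.

Lemma cd_check2 (k j : 'I_(2 ^ r)) :
  [/\ (cd_idx r k j < 2 ^ r)%N, cd_idx r k j = cd_idx r j k,
      cd_sgn r k j = cd_sgn r j k (+) chi k j,
      k != 0 :> nat -> cd_sgn r k (cd_idx r k j) (+) cd_sgn r j k
                        = ((j == 0 :> nat) || (j == k))
    & forall s : 'I_(2 ^ r),
        cd_idx r k (cd_idx r j s) = cd_idx r (cd_idx r k j) s].
Proof.
have /andP[_ /allP H] := cd_check_true.
have /allP H1 := H _ (mem_iota_ord k).
have /and5P[h1 /eqP h2 /eqP h3 h4 /allP h5] := H1 _ (mem_iota_ord j).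
split => // [k0|s]; last by apply/eqP/h5/mem_iota_ord.
by move: h4; rewrite (negbTE k0) => /eqP.
Qed.

(** Up to sign the generators form an elementary abelian 2-group under this operation, so each index
    is its own inverse. The default value of [insubd] never occurs. *)
Definition oidx (k j : 'I_(2 ^ r)) : 'I_(2 ^ r) := insubd k (cd_idx r k j).

Lemma val_oidx k j : oidx k j = cd_idx r k j :> nat.
Proof. by rewrite val_insubd; case: (cd_check2 k j) => ->. Qed.

Lemma oidxC k j : oidx k j = oidx j k.
Proof. by apply: val_inj; rewrite /= !val_oidx; case: (cd_check2 k j). Qed.

Lemma oidxA k j s : oidx k (oidx j s) = oidx (oidx k j) s.
Proof.
by apply: val_inj; rewrite /= !val_oidx; case: (cd_check2 k j) => _ _ _ _ ->.
Qed.

Fact ord_zero_subproof : (0 < 2 ^ r)%N. Proof. by rewrite expn_gt0. Qed.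
Definition oz : 'I_(2 ^ r) := Ordinal ord_zero_subproof.

Lemma ozE (k : 'I_(2 ^ r)) : (k == 0 :> nat) = (k == oz). Proof. by []. Qed.

Lemma oidx0k k : oidx oz k = k.
Proof. by apply: val_inj; rewrite /= val_oidx cd_idx0k. Qed.

Lemma oidxk0 k : oidx k oz = k. Proof. by rewrite oidxC oidx0k. Qed.

Lemma oidxkk k : oidx k k = oz.
Proof.
apply: val_inj; rewrite /= val_oidx.
by case: hr k => -> -[]; do 8?[case=> //].
Qed.

Lemma oidxKl k j : oidx k (oidx k j) = j.
Proof. by rewrite oidxA oidxkk oidx0k. Qed.

Lemma oidx_eq (k j l : 'I_(2 ^ r)) : (cd_idx r k j == l) = (j == oidx k l).
Proof.
rewrite -val_oidx; apply/eqP/eqP => [/val_inj<-|->]; first by rewrite oidxKl.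
by rewrite oidxKl.
Qed.

End CayleyDicksonTable.

(** * Bimodules over A_r and their real parts *)

Section Bimodules.
Variables (R : realType) (r : nat) (hr : r = 2%N \/ r = 3%N).
Implicit Types (V W : lmodType R).

Local Notation sg j l := (cd_sgn r j (oidx j l)).

(** As indices are their own inverses, [i_j i_k] is proportional to [i_l] exactly for
    [k = oidx j l]; the inner sum of the definition has this single term, with sign [sg j l]. *)
Lemma lactE V a (x : AV r V) l :
  lact a x l = \sum_(j < 2 ^ r) (-1) ^+ sg j l *: (a j *: x (oidx j l)).
Proof.
rewrite ffunE; apply: eq_bigr => j _.
by rewrite (eq_bigl (pred1 (oidx j l))) ?big_pred1_eq // => k; exact: oidx_eq.
Qed.

Lemma ractE V a (x : AV r V) l :
  ract x a l = \sum_(j < 2 ^ r) (-1) ^+ sg j l *: (a (oidx j l) *: x j).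
Proof.
rewrite ffunE; apply: eq_bigr => j _.
by rewrite (eq_bigl (pred1 (oidx j l))) ?big_pred1_eq // => k; exact: oidx_eq.
Qed.

Lemma real0E V (v : V) : real0 r v = pure (oz r) v.
Proof. by apply/ffunP => j; rewrite !ffunE. Qed.

Lemma cdgenE (k j : 'I_(2 ^ r)) : cdgen R k j = (j == k)%:R.
Proof. by rewrite ffunE; case: eqP. Qed.

Lemma lact_gen V k (x : AV r V) l :
  lact (cdgen R k) x l = (-1) ^+ sg k l *: x (oidx k l).
Proof.
rewrite lactE (bigD1 k) //= cdgenE eqxx scale1r big1 ?addr0 // => j /negbTE jk.
by rewrite cdgenE jk scale0r scaler0.
Qed.

Lemma ract_gen V k (x : AV r V) l :
  ract x (cdgen R k) l = (-1) ^+ cd_sgn r (oidx k l) k *: x (oidx k l).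
Proof.
have e : oidx (oidx k l) l = k by rewrite -oidxA // oidxkk // oidxk0.
rewrite ractE (bigD1 (oidx k l)) //= e cdgenE eqxx scale1r big1 ?addr0 // => j jk.
rewrite cdgenE; case: eqP => [ek|]; last by rewrite scale0r scaler0.
by case/eqP: jk; rewrite -ek -oidxA // oidxkk // oidxk0.
Qed.

Lemma lact_real0 V a (v : V) : lact a (real0 r v) = [ffun k => a k *: v].
Proof.
apply/ffunP => l; rewrite lactE ffunE (bigD1 l) //= big1 => [|j jl].
  by rewrite oidxkk // real0E ffunE eqxx addr0 cd_sgnk0 // scale1r.
rewrite real0E ffunE; case: eqP => [e|]; last by rewrite !scaler0.
by case/eqP: jl; rewrite -[j](oidxk0 hr) -e oidxKl.
Qed.

Lemma ract_real0 V a (v : V) : ract (real0 r v) a = [ffun k => a k *: v].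
Proof.
apply/ffunP => l; rewrite ractE ffunE (bigD1 (oz r)) //= big1 => [|j jl].
  by rewrite real0E ffunE eqxx addr0 oidx0k // cd_sgn0k // scale1r.
by rewrite real0E ffunE (negbTE jl) !scaler0.
Qed.

Lemma lact_scale V (t : R) (x : AV r V) : lact (t *: cdgen R (oz r)) x = t *: x.
Proof.
apply/ffunP => l; rewrite lactE (bigD1 (oz r)) //= big1 => [|j jl].
  by rewrite !ffunE eqxx addr0 oidx0k // cd_sgn0k // scale1r [_ *: 1]mulr1.
by rewrite !ffunE (negbTE jl) scaler0 scale0r scaler0.
Qed.

Lemma lact_genE V k (v : V) : lact (cdgen R k) (real0 r v) = pure k v.
Proof.
rewrite lact_real0; apply/ffunP => j; rewrite !ffunE.
by case: eqP => _; rewrite ?scale1r ?scale0r.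
Qed.

Lemma AV_sum_pure V (x : AV r V) : x = \sum_(k < 2 ^ r) pure k (x k).
Proof.
apply/ffunP => l; rewrite sum_ffunE (bigD1 l) //= ffunE eqxx big1 ?addr0 //.
by move=> j jl; rewrite ffunE eq_sym (negbTE jl).
Qed.

Lemma AVsubZ V (P : set (AV r V)) t x : AVsub P -> P x -> P (t *: x).
Proof. by move=> [_ _ Pl _] /Pl h; rewrite -lact_scale; apply: h. Qed.

Lemma AVsub_sum V (P : set (AV r V)) (I : Type) (s : seq I) (Q : pred I) F :
  AVsub P -> (forall i, Q i -> P (F i)) -> P (\sum_(i <- s | Q i) F i).
Proof. by move=> [P0 Pa _ _] h; apply: big_ind. Qed.

Lemma AVsubB V (P : set (AV r V)) x y : AVsub P -> P x -> P y -> P (x - y).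
Proof.
by move=> hP Px Py; rewrite -scaleN1r; case: (hP) => _ + _ _; apply => //; exact: AVsubZ.
Qed.

(* The projection to the span of i_0 and i_k. *)
Definition av_proj V (k : 'I_(2 ^ r)) (x : AV r V) : AV r V :=
  2^-1 *: (x - lact (cdgen R k) (ract x (cdgen R k))).

(** On pure states of index [j] the operator [x |-> i_k (x i_k)] is the sign of [i_k (i_j i_k)]:
    minus one for [j = 0] and [j = k], plus one otherwise. The difference doubles the former and
    cancels the latter. *)
Lemma av_projE V (k : 'I_(2 ^ r)) (x : AV r V) j : k != oz r ->
  av_proj k x j = if (j == oz r) || (j == k) then x j else 0.
Proof.
move=> k0; have ffE (y : AV r V) : (2^-1 *: (x - y)) j = 2^-1 *: (x j - y j).
  by rewrite !ffunE.
rewrite /av_proj ffE lact_gen ract_gen oidxKl // scalerA.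
rewrite -signr_addb.
have [_ _ _ H _] := cd_check2 hr k j.
rewrite val_oidx // H // ozE; case: ifP => _.
  by rewrite expr1 scaleN1r opprK -mulr2n -scaler_nat scalerA mulVf ?scale1r ?pnatr_eq0.
by rewrite expr0 scale1r subrr scaler0.
Qed.

Lemma exists_two_units : exists k1 k2 : 'I_(2 ^ r),
  [/\ k1 != oz r, k2 != oz r & k1 != k2].
Proof.
have h : (2 < 2 ^ r)%N by case: hr => ->.
by exists (Ordinal (ltnW h)), (Ordinal h).
Qed.

(** The spans of 1 and one imaginary unit, for two different units, meet in the real part; two such
    units exist because [r] is at least 2. They are chosen before [V], so that one choice serves
    both the source and the target of a bimodule map. *)
Lemma av_proj_real : exists k1 k2 : 'I_(2 ^ r),
  forall V (x : AV r V), real0 r (x (oz r)) = av_proj k1 (av_proj k2 x).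
Proof.
have [k1 [k2 [h1 h2 h12]]] := exists_two_units.
exists k1, k2 => V x; apply/ffunP => j; rewrite !av_projE // real0E ffunE.
case: (j =P oz r) => [->|_] //=; case: eqP => // ->.
by rewrite (negbTE h12).
Qed.

Lemma AVsub_proj V (P : set (AV r V)) k x : AVsub P -> P x -> P (av_proj k x).
Proof.
move=> hP Px; apply: AVsubZ => //; apply: AVsubB => //.
by case: hP => _ _ Pl Pr; apply/Pl/Pr.
Qed.

Lemma real0_comp V k (x : AV r V) :
  real0 r (x k) = (-1) ^+ cd_sgn r k k *: real0 r (lact (cdgen R k) x (oz r)).
Proof.
rewrite lact_gen oidxk0 //; apply/ffunP => j; rewrite !ffunE.
by case: ifP => _; rewrite ?scaler0 // scalerA -signr_addb addbb scale1r.
Qed.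

(** Up to sign the component of index [k] is the real part of [i_k x], and taking real parts is
    composed of bimodule operations. With [AVsubP] this identifies a sub-bimodule with [avset] of
    its real part. *)
Lemma AVsub_comp V (P : set (AV r V)) (x : AV r V) k : AVsub P -> P x -> P (real0 r (x k)).
Proof.
move=> hP Px; rewrite real0_comp; apply: AVsubZ => //.
have [k1 [k2 ->]] := av_proj_real; do 2!apply: AVsub_proj => //.
by case: hP => _ _ + _; apply.
Qed.

Lemma AVsub_pure V (P : set (AV r V)) v k :
  AVsub P -> P (real0 r v) -> P (pure k v).
Proof. by move=> [_ _ Pl _] Pv; rewrite -lact_genE; apply: Pl. Qed.

Lemma AVsubP V (P : set (AV r V)) (x : AV r V) :
  AVsub P -> (forall k, P (real0 r (x k))) -> P x.
Proof.
move=> hP Px; rewrite (AV_sum_pure x); apply: AVsub_sum => // k _.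
exact: AVsub_pure.
Qed.

Definition avset V (P : set V) : set (AV r V) := [set x | forall k, P (x k)].

Definition submod V (P : set V) : Prop :=
  P 0 /\ forall (t : R) x y, P x -> P y -> P (t *: x + y).

Lemma submodD V (P : set V) x y : submod P -> P x -> P y -> P (x + y).
Proof. by move=> [_ h] Px Py; rewrite -[x]scale1r; apply: h. Qed.

Lemma submodZ V (P : set V) t x : submod P -> P x -> P (t *: x).
Proof. by move=> [P0 h] Px; rewrite -[_ *: _]addr0; apply: h. Qed.

Lemma submodN V (P : set V) x : submod P -> P x -> P (- x).
Proof. by move=> hP Px; rewrite -scaleN1r; apply: submodZ. Qed.

Lemma submodB V (P : set V) x y : submod P -> P x -> P y -> P (x - y).
Proof. by move=> hP Px Py; apply: submodD => //; apply: submodN. Qed.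

Lemma submod_sum V (P : set V) (I : Type) (s : seq I) (Q : pred I) F :
  submod P -> (forall i, Q i -> P (F i)) -> P (\sum_(i <- s | Q i) F i).
Proof.
by move=> hP h; apply: big_ind => [|x y|]; [case: hP|exact: submodD|].
Qed.

Lemma AVsub_avset V (P : set V) : submod P -> AVsub (avset P).
Proof.
move=> hP; split.
- by move=> k; rewrite ffunE; case: hP.
- by move=> x y Px Py k; rewrite ffunE; apply: submodD.
- move=> a x Px k; rewrite lactE; apply: submod_sum => // j _.
  by do 2!apply: submodZ => //.
- move=> a x Px k; rewrite ractE; apply: submod_sum => // j _.
  by do 2!apply: submodZ => //.
Qed.

Lemma avset_real0 V (P : set V) v : submod P -> avset P (real0 r v) <-> P v.
Proof.
move=> hP; split => [/(_ (oz r))|Pv k]; rewrite real0E ffunE ?eqxx //.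
by case: ifP => _ //; case: hP.
Qed.

Lemma real0D V (u v : V) : real0 r (u + v) = real0 r u + real0 r v.
Proof. by apply/ffunP => j; rewrite !ffunE; case: ifP; rewrite ?addr0. Qed.

Lemma real0Z V t (u : V) : real0 r (t *: u) = t *: real0 r u.
Proof. by apply/ffunP => j; rewrite !ffunE; case: ifP; rewrite ?scaler0. Qed.

Lemma real00 V : real0 r (0 : V) = 0.
Proof. by apply/ffunP => j; rewrite !ffunE if_same. Qed.

Lemma real0N V (u : V) : real0 r (- u) = - real0 r u.
Proof. by rewrite -scaleN1r real0Z scaleN1r. Qed.

Lemma real0_oz V (u : V) : real0 r u (oz r) = u.
Proof. by rewrite ffunE. Qed.

Lemma real0_inj V : injective (@Defs.real0 R r V).
Proof. by move=> u v e; have := congr1 (fun x : AV r V => x (oz r)) e; rewrite !real0_oz. Qed.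

Lemma zero_part_real0 V (x : AV r V) : zero_part x -> x = real0 r (x (oz r)).
Proof. by case=> v ->; rewrite real0_oz. Qed.

Lemma pure_real V (v : V) : pure (oz r) v = real0 r v.
Proof. by rewrite real0E. Qed.

Lemma AVsub_submod V (P : set (AV r V)) :
  AVsub P -> submod (fun u => P (real0 r u)).
Proof.
move=> hP; split=> [|t x y Px Py]; first by rewrite real00; case: hP.
rewrite real0D real0Z; case: (hP) => _ + _ _; apply => //; exact: AVsubZ.
Qed.

Definition avmap V W (f : V -> W) (x : AV r V) : AV r W := [ffun k => f (x k)].

(** Linearity is relative to a subset because a homomorphism on [eta_+] or [eta_-] is represented by
    a function on the whole algebra, with arbitrary values elsewhere. *)
Definition lin_on V W (P : set V) (f : V -> W) : Prop :=
  forall (t : R) x y, P x -> P y -> f (t *: x + y) = t *: f x + f y.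

Section LinOn.
Variables (V W : lmodType R) (P : set V) (f : V -> W).
Hypotheses (hP : submod P) (hf : lin_on P f).

Lemma lin_onD x y : P x -> P y -> f (x + y) = f x + f y.
Proof. by move=> Px Py; rewrite -[x]scale1r hf // !scale1r. Qed.

Lemma lin_on0 : f 0 = 0.
Proof.
have P0 := proj1 hP.
by apply: (addIr (f 0)); rewrite -lin_onD // !add0r.
Qed.

Lemma lin_onZ t x : P x -> f (t *: x) = t *: f x.
Proof.
by move=> Px; rewrite -[t *: x]addr0 hf //; [rewrite lin_on0 addr0|case: hP].
Qed.

Lemma lin_onN x : P x -> f (- x) = - f x.
Proof. by move=> Px; rewrite -scaleN1r lin_onZ // scaleN1r. Qed.

Lemma lin_onB x y : P x -> P y -> f (x - y) = f x - f y.
Proof. by move=> Px Py; rewrite lin_onD ?lin_onN //; apply: submodN. Qed.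

Lemma lin_on_sum (I : Type) (s : seq I) (Q : pred I) (F : I -> V) :
  (forall i, P (F i)) -> f (\sum_(i <- s | Q i) F i) = \sum_(i <- s | Q i) f (F i).
Proof.
move=> h; elim: s => [|i s IH]; first by rewrite !big_nil lin_on0.
rewrite !big_cons; case: ifP => // _; rewrite lin_onD ?IH //.
exact: submod_sum.
Qed.

End LinOn.

Lemma submodT V : submod (@setT V). Proof. by []. Qed.

Lemma AVhom_avmap V W (P : set V) (f : V -> W) :
  submod P -> lin_on P f -> AVhom (avset P) (avmap f).
Proof.
move=> hP hf; split.
- by move=> x y Px Py; apply/ffunP => k; rewrite !ffunE (lin_onD hf).
- by move=> t x Px; apply/ffunP => k; rewrite !ffunE (lin_onZ hP hf).
- move=> a x Px; apply/ffunP => k; rewrite ffunE !lactE.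
  rewrite (lin_on_sum hP hf) => [|i]; last by do 2!apply: submodZ => //.
  by apply: eq_bigr => j _; rewrite !(lin_onZ hP hf) ?ffunE //; exact: submodZ.
- move=> a x Px; apply/ffunP => k; rewrite ffunE !ractE.
  rewrite (lin_on_sum hP hf) => [|i]; last by do 2!apply: submodZ => //.
  by apply: eq_bigr => j _; rewrite !(lin_onZ hP hf) ?ffunE //; exact: submodZ.
Qed.

Section HomComponents.
Variables (V W : lmodType R) (P : set (AV r V)) (phi : AV r V -> AV r W).
Hypotheses (hP : AVsub P) (hphi : AVhom P phi).

Lemma AVhom_proj k x : P x -> phi (av_proj k x) = av_proj k (phi x).
Proof.
case: hphi => phiD phiZ phil phir Px.
have [_ Pa Pl Pr] := hP.
rewrite /av_proj phiZ; last by apply: AVsubB => //; apply/Pl/Pr.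
rewrite -scaleN1r phiD //; last by apply: AVsubZ => //; apply/Pl/Pr.
by rewrite phiZ ?phil ?phir ?scaleN1r //; [apply: Pr|apply/Pl/Pr].
Qed.

(** The passage to a component is made of left and right multiplications, which [phi] respects.
    Hence [phi] is one real map applied to every component, as [AVhomE] records. *)
Lemma AVhom_comp (x : AV r V) k : P x -> phi (real0 r (x k)) = real0 r (phi x k).
Proof.
case: (hphi) => phiD phiZ phil phir Px; have [_ Pa Pl Pr] := hP.
have [k1 [k2 e]] := av_proj_real.
rewrite real0_comp phiZ e; last by do 2!apply: AVsub_proj => //; apply: Pl.
rewrite !AVhom_proj // ?phil -?e -?real0_comp //; first exact: Pl.
by apply: AVsub_proj => //; apply: Pl.
Qed.

Lemma AVhomE x : P x -> phi x = avmap (fun u => phi (real0 r u) (oz r)) x.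
Proof.
by move=> Px; apply/ffunP => k; rewrite ffunE AVhom_comp // real0_oz.
Qed.

Lemma AVhom_real0 v : P (real0 r v) ->
  phi (real0 r v) = real0 r (phi (real0 r v) (oz r)).
Proof. by move=> Pv; rewrite -AVhom_comp // real0_oz. Qed.

Lemma AVhom_lin_on :
  lin_on (fun u => P (real0 r u)) (fun u => phi (real0 r u) (oz r)).
Proof.
case: hphi => phiD phiZ _ _ t u v Pu Pv.
by rewrite real0D real0Z phiD ?phiZ ?ffunE //; apply: AVsubZ.
Qed.

End HomComponents.

Lemma avmap_real0 V W (f : V -> W) v : f 0 = 0 ->
  avmap f (real0 r v) = real0 r (f v).
Proof. by move=> f0; apply/ffunP => k; rewrite !ffunE; case: ifP. Qed.

End Bimodules.

(** * Real Lie algebras, ideals and generated subalgebras *)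

Section RealLieAlgebras.
Variable R : realType.

Record is_lie (V : lmodType R) (br : V -> V -> V) : Prop := IsLie {
  il_l : forall (t : R) x y z, br (t *: x + y) z = t *: br x z + br y z;
  il_r : forall (t : R) x y z, br z (t *: x + y) = t *: br z x + br z y;
  il_anti : forall u v, br u v = - br v u;
  il_jac : forall u v w, br u (br v w) = br (br u v) w + br v (br u w)
}.

Section Basics.
Variables (V : lmodType R) (br : V -> V -> V) (lie : is_lie br).

Lemma br_lin_l z : lin_on setT (br^~ z).
Proof. by move=> t x y _ _; apply: il_l. Qed.

Lemma br_lin_r z : lin_on setT (br z).
Proof. by move=> t x y _ _; apply: il_r. Qed.

Lemma brDl x y z : br (x + y) z = br x z + br y z.
Proof. exact: (lin_onD (br_lin_l z)). Qed.
Lemma brDr x y z : br z (x + y) = br z x + br z y.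
Proof. exact: (lin_onD (br_lin_r z)). Qed.
Lemma brZl t x z : br (t *: x) z = t *: br x z.
Proof. exact: (lin_onZ (submodT V) (br_lin_l z)). Qed.
Lemma brZr t x z : br z (t *: x) = t *: br z x.
Proof. exact: (lin_onZ (submodT V) (br_lin_r z)). Qed.
Lemma br0l z : br 0 z = 0.
Proof. exact: (lin_on0 (submodT V) (br_lin_l z)). Qed.
Lemma br0r z : br z 0 = 0.
Proof. exact: (lin_on0 (submodT V) (br_lin_r z)). Qed.
Lemma brNl x z : br (- x) z = - br x z.
Proof. exact: (lin_onN (submodT V) (br_lin_l z)). Qed.
Lemma brNr x z : br z (- x) = - br z x.
Proof. exact: (lin_onN (submodT V) (br_lin_r z)). Qed.
Lemma br_sumr z (I : Type) (s : seq I) (Q : pred I) (F : I -> V) :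
  br z (\sum_(i <- s | Q i) F i) = \sum_(i <- s | Q i) br z (F i).
Proof. exact: (lin_on_sum (submodT V) (br_lin_r z)). Qed.

End Basics.

Definition lsub (V : lmodType R) (br : V -> V -> V) (P : set V) : Prop :=
  submod P /\ forall x y, P x -> P y -> P (br x y).

Definition lideal (V : lmodType R) (br : V -> V -> V) (P : set V) : Prop :=
  submod P /\ forall x y, P y -> P (br x y).

Definition lgen (V : lmodType R) (br : V -> V -> V) (S : set V) : set V :=
  [set x | forall P, lsub br P -> S `<=` P -> P x].

Definition lhom_on (V W : lmodType R) (brV : V -> V -> V) (brW : W -> W -> W)
    (P : set V) (f : V -> W) : Prop :=
  lin_on P f /\ forall x y, P x -> P y -> f (brV x y) = brW (f x) (f y).

Lemma lsub_lgen (V : lmodType R) (br : V -> V -> V) S : lsub br (lgen br S).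
Proof.
split; first split; first by move=> P [[]].
  by move=> t x y hx hy P hP SP; apply: (proj2 (proj1 hP)); [exact: hx|exact: hy].
by move=> x y hx hy P hP SP; apply: (proj2 hP); [exact: hx|exact: hy].
Qed.

Lemma sub_lgen (V : lmodType R) (br : V -> V -> V) S : S `<=` lgen br S.
Proof. by move=> x Sx P _; apply. Qed.

End RealLieAlgebras.

(** * The tensor product of A_r with a real Lie algebra *)

Section Complexification.
Variables (R : realType) (r : nat) (hr : r = 2%N \/ r = 3%N).

Local Notation sg j l := (cd_sgn r j (oidx j l)).

Definition avbr (V : lmodType R) (br : V -> V -> V) (x y : AV r V) : AV r V :=
  [ffun l => \sum_(j < 2 ^ r) (-1) ^+ sg j l *: br (x j) (y (oidx j l))].

Section Avbr.
Variables (V : lmodType R) (br : V -> V -> V) (lie : is_lie br).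

Lemma avbr_pure k j u v :
  avbr br (pure k u) (pure j v) = pure (oidx k j) ((-1) ^+ cd_sgn r k j *: br u v).
Proof.
apply/ffunP => l; rewrite ffunE (bigD1 k) //= big1 => [|i ik].
  rewrite !ffunE eqxx addr0.
  have -> : (oidx k l == j) = (l == oidx k j).
    by apply/eqP/eqP => [<-|->]; rewrite oidxKl.
  case: eqP => [->|_]; first by rewrite oidxKl.
  by rewrite br0r // scaler0.
by rewrite !ffunE (negbTE ik) br0l // scaler0.
Qed.

Lemma avbr_linl (t : R) x y z :
  avbr br (t *: x + y) z = t *: avbr br x z + avbr br y z.
Proof.
apply/ffunP => l; rewrite !ffunE scaler_sumr -big_split; apply: eq_bigr => j _.
by rewrite !ffunE il_l // scalerDr !scalerA mulrC.
Qed.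

Lemma avbr_linr (t : R) x y z :
  avbr br z (t *: x + y) = t *: avbr br z x + avbr br z y.
Proof.
apply/ffunP => l; rewrite !ffunE scaler_sumr -big_split; apply: eq_bigr => j _.
by rewrite !ffunE il_r // scalerDr !scalerA mulrC.
Qed.

Lemma pureZ k t (v : V) : pure k (t *: v) = t *: pure k v :> AV r V.
Proof. by apply/ffunP => j; rewrite !ffunE; case: eqP; rewrite ?scaler0. Qed.

Lemma pureD k (u v : V) : pure k (u + v) = pure k u + pure k v :> AV r V.
Proof. by apply/ffunP => j; rewrite !ffunE; case: eqP; rewrite ?addr0. Qed.

Lemma avbr_real0 u v : avbr br (real0 r u) (real0 r v) = real0 r (br u v).
Proof. by rewrite !real0E avbr_pure oidx0k // cd_sgn0k // scale1r. Qed.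

Lemma avbr_pure3 k j s u v w :
  avbr br (pure k u) (avbr br (pure j v) (pure s w))
  = (-1) ^+ cd_sgn3 r k j s *: pure (oidx (oidx k j) s) (br u (br v w)).
Proof.
rewrite !avbr_pure -oidxA // pureZ brZr // pureZ scalerA -signr_addb.
by rewrite /cd_sgn3 addbC val_oidx.
Qed.

(** The signs [chi] and [xi] compensate those of the table. The three Jacobi terms are multiples of
    one generator, and after multiplication by the [xi] signs all carry the sign [c1] of
    [i_k (i_j i_s)]; what remains is the real Jacobi identity. *)
Lemma avbr_axiom : lieA_axiom (avbr br).
Proof.
split.
- exact: avbr_linl.
- exact: avbr_linr.
- by move=> u v; exists (br u v); rewrite avbr_real0.
- move=> k j u v; rewrite !avbr_pure oidxC // -pureZ; congr pure.
  have [_ _ -> _ _] := cd_check2 hr k j.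
  rewrite (il_anti lie u v) scalerA exprS mulN1r mulNr -signr_addb addbC.
  by rewrite scalerN scaleNr.
- move=> k j s u v w; rewrite !avbr_pure3.
  have -> : oidx (oidx j s) k = oidx (oidx k j) s by rewrite oidxC // oidxA.
  have -> : oidx (oidx s k) j = oidx (oidx k j) s by rewrite -oidxA // oidxC.
  rewrite !scalerA exprD -!signr_addb /xi.
  move: (cd_sgn3 r k j s) (cd_sgn3 r j s k) (cd_sgn3 r s k j) => c1 c2 c3.
  have -> : (c1 (+) c2) (+) c2 = c1 by case: c1; case: c2.
  have -> : ((c1 (+) c2) (+) (c2 (+) c3)) (+) c3 = c1.
    by case: c1; case: c2; case: c3.
  rewrite -!scalerDr -!pureD (il_jac lie u) (il_anti lie w (br u v)).
  rewrite (il_anti lie w u) (brNr lie) addrK subrr -(scale0r (0 : V)) pureZ.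
  by rewrite scale0r scaler0.
Qed.

End Avbr.
End Complexification.

(** * Scalar compatible algebras as tensor products with their real part *)

Section Transfer.
Variables (R : realType) (r : nat) (hr : r = 2%N \/ r = 3%N).

Definition mkLie (V : lmodType R) (br : V -> V -> V) (lie : is_lie br) : lieA R r :=
  LieA (avbr_axiom hr lie).

Lemma scalar_compat_mkLie (V : lmodType R) (br : V -> V -> V) (lie : is_lie br) :
  scalar_compat (mkLie lie).
Proof.
move=> a b u v; rewrite /= avbr_real0 // !lact_real0 // ract_real0 //; split=> //.
apply/ffunP => l; rewrite [LHS]ffunE [RHS]ffunE /cdmul lactE // scaler_suml;
  apply: eq_bigr => j _.
by rewrite !ffunE brZl // brZr // !scalerA mulrA.
Qed.

Definition rbr (g : lieA R r) (u v : g) : g := lbr (real0 r u) (real0 r v) (oz r).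

Section OneAlgebra.
Variables (g : lieA R r) (sc : scalar_compat g).

Lemma lbr_real0 (u v : g) : lbr (real0 r u) (real0 r v) = real0 r (rbr u v).
Proof. exact/zero_part_real0/(la_zero (lieA_prf g)). Qed.

Lemma lbrDl (x y z : AV r g) : lbr (x + y) z = lbr x z + lbr y z.
Proof. by have := la_linl (lieA_prf g) 1 x y z; rewrite !scale1r. Qed.

Lemma lbrDr (x y z : AV r g) : lbr z (x + y) = lbr z x + lbr z y.
Proof. by have := la_linr (lieA_prf g) 1 x y z; rewrite !scale1r. Qed.

Lemma lbr0l (z : AV r g) : lbr 0 z = 0.
Proof. by apply: (addIr (lbr 0 z)); rewrite -lbrDl !add0r. Qed.

Lemma lbr0r (z : AV r g) : lbr z 0 = 0.
Proof. by apply: (addIr (lbr z 0)); rewrite -lbrDr !add0r. Qed.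

Lemma rbr_lie : is_lie (@rbr g).
Proof.
have prf := lieA_prf g.
have anti (x y : g) : rbr x y = - rbr y x.
  apply: (@real0_inj _ r); rewrite real0N -!lbr_real0 !real0E.
  by rewrite (la_anti prf) /chi /= expr1 scaleN1r.
split=> [t x y z|t x y z|u v|u v w].
- by rewrite /rbr real0D real0Z (la_linl prf) !ffunE.
- by rewrite /rbr real0D real0Z (la_linr prf) !ffunE.
- exact: anti.
- apply: (@real0_inj _ r).
  have := la_jacobi prf (oz r) (oz r) (oz r) u v w.
  rewrite /xi addbb !expr0 !scale1r !pure_real !lbr_real0 -!real0D.
  rewrite -[X in _ = X -> _](real00 r g) => /real0_inj h; congr real0.
  (* [brNr] cannot be used here, since it presupposes the [is_lie] structure under proof. *)
  have linN (x y : g) : rbr x (- y) = - rbr x y.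
    have := la_linr prf (-1) (real0 r y) 0 (real0 r x).
    rewrite lbr0r !addr0 !scaleN1r -real0N !lbr_real0 -real0N.
    exact: real0_inj.
  move/eqP: h; rewrite -addrA addr_eq0 => /eqP ->.
  by rewrite opprD addrC -anti -linN -anti.
Qed.

(** A pure state is [i_k u] with [u] real, so scalar compatibility forces [[i_k u, i_j v] = (i_k
    i_j) [u, v]]; biadditivity gives the rest. All later transfer between A_r and the reals goes
    through this formula. *)
Lemma lbrE (x y : AV r g) : lbr x y = avbr (@rbr g) x y.
Proof.
have H k j (u v : g) : lbr (pure k u) (pure j v) = avbr (@rbr g) (pure k u) (pure j v).
  rewrite -[pure k u]lact_genE // -[pure j v]lact_genE //.
  rewrite (proj1 (sc _ _ _ _)) lbr_real0 lact_real0 //.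
  rewrite !lact_genE // avbr_pure //; last exact: rbr_lie.
  apply/ffunP => l; rewrite [LHS]ffunE [RHS]ffunE /cdmul lact_gen // cdgenE //.
  have -> : (oidx k l == j) = (l == oidx k j).
    by apply/eqP/eqP => [<-|->]; rewrite oidxKl.
  case: eqP => [->|_]; last by rewrite scaler0 scale0r.
  by rewrite oidxKl // [_ *: 1]mulr1.
rewrite [in LHS](AV_sum_pure x) [in LHS](AV_sum_pure y).
rewrite [in RHS](AV_sum_pure x) [in RHS](AV_sum_pure y).
have bD (a b c : AV r g) : avbr (@rbr g) (a + b) c = avbr (@rbr g) a c + avbr (@rbr g) b c.
  by have := avbr_linl rbr_lie 1 a b c; rewrite !scale1r.
have bDr (a b c : AV r g) : avbr (@rbr g) c (a + b) = avbr (@rbr g) c a + avbr (@rbr g) c b.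
  by have := avbr_linr rbr_lie 1 a b c; rewrite !scale1r.
have b0 (c : AV r g) : avbr (@rbr g) 0 c = 0.
  by apply: (addIr (avbr (@rbr g) 0 c)); rewrite -bD !add0r.
have b0r (c : AV r g) : avbr (@rbr g) c 0 = 0.
  by apply: (addIr (avbr (@rbr g) c 0)); rewrite -bDr !add0r.
apply: (big_ind (fun a => lbr a _ = avbr (@rbr g) a _)).
- by rewrite lbr0l b0.
- by move=> a b ha hb; rewrite lbrDl bD ha hb.
move=> k _; apply: (big_ind (fun a => lbr _ a = avbr (@rbr g) _ a)).
- by rewrite lbr0r b0r.
- by move=> a b ha hb; rewrite lbrDr bDr ha hb.
by move=> j _; rewrite H.
Qed.

Lemma lie_sub_avset (P : set g) : lsub (@rbr g) P -> lie_sub (avset (r := r) P).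
Proof.
move=> [hP hb]; split; first exact: AVsub_avset.
move=> x y Px Py l; rewrite lbrE ffunE; apply: submod_sum => // j _.
by apply: submodZ => //; apply: hb.
Qed.

Lemma lie_sub_real (P : set (AV r g)) :
  lie_sub P -> lsub (@rbr g) (fun u => P (real0 r u)).
Proof.
move=> [hP hb]; split; first exact: AVsub_submod.
by move=> u v Pu Pv; rewrite -lbr_real0; apply: hb.
Qed.

Lemma lie_genE (S : set g) :
  lie_gen [set real0 r u | u in S] = avset (r := r) (lgen (@rbr g) S).
Proof.
rewrite predeqE => x; split=> [hx|hx P hP SP].
  apply: hx; first exact/lie_sub_avset/lsub_lgen.
  move=> _ [u Su <-]; apply/avset_real0; first by case: (lsub_lgen (@rbr g) S).
  exact: sub_lgen.
apply: (AVsubP hr (proj1 hP)) => k.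
apply: (hx k (fun u => P (real0 r u))); first exact: lie_sub_real.
by move=> u Su; apply: SP; exists u.
Qed.

Lemma lie_ideal_avset (P : set g) : lideal (@rbr g) P -> lie_ideal (avset (r := r) P).
Proof.
move=> [hP hb]; split; first exact: AVsub_avset.
move=> x y Py; split=> l; rewrite lbrE ffunE; apply: submod_sum => // j _.
  by apply: submodZ => //; apply: hb.
apply: submodZ => //; rewrite (il_anti rbr_lie); apply: submodN => //; exact: hb.
Qed.

Lemma lie_ideal_real (P : set (AV r g)) :
  lie_ideal P -> lideal (@rbr g) (fun u => P (real0 r u)).
Proof.
move=> [hP hb]; split; first exact: AVsub_submod.
by move=> u v Pv; rewrite -lbr_real0; case: (hb (real0 r u) (real0 r v)).
Qed.

End OneAlgebra.

Lemma lie_hom_avmap (g k : lieA R r) (sg : scalar_compat g) (sk : scalar_compat k)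
    (P : set g) (f : g -> k) : lsub (@rbr g) P -> lhom_on (@rbr g) (@rbr k) P f ->
  lie_hom_on (avset (r := r) P) (avmap f).
Proof.
move=> [hP hb] [fl fb]; split; first exact: AVhom_avmap.
move=> x y Px Py; apply/ffunP => l; rewrite !lbrE // !ffunE.
rewrite (lin_on_sum hP fl) => [|j]; last by apply: submodZ => //; apply: hb.
by apply: eq_bigr => j _; rewrite (lin_onZ hP fl) ?fb ?ffunE //; apply: hb.
Qed.

Lemma lie_hom_real (g k : lieA R r) (P : set (AV r g)) (phi : AV r g -> AV r k) :
  AVsub P -> lie_hom_on P phi ->
  lhom_on (@rbr g) (@rbr k) (fun u => P (real0 r u)) (fun u => phi (real0 r u) (oz r)).
Proof.
move=> hP [hl hb]; split; first exact: AVhom_lin_on.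
move=> u v Pu Pv; rewrite -lbr_real0 hb //.
by rewrite (AVhom_real0 hr hP hl Pu) (AVhom_real0 hr hP hl Pv) lbr_real0 !real0_oz.
Qed.

End Transfer.

(** * Subspaces as Lie algebras in their own right *)

Section SubmoduleType.
Variables (R : realType) (V : lmodType R) (P : set V) (hP : submod P).

(** The proof of [submod P] is an argument so that the closure properties can be registered as
    instances for this predicate. *)
Definition submod_pred of submod P : {pred V} := fun x => `[< P x >].

Fact submod_predP x : reflect (P x) (x \in submod_pred hP).
Proof. exact: asboolP. Qed.

Fact submod_pred_closed : GRing.subsemimod_closed (submod_pred hP).
Proof.
split; first split.
- by apply/submod_predP; case: hP.
- by move=> x y /submod_predP Px /submod_predP Py; apply/submod_predP; exact: submodD.
- by move=> t x /submod_predP Px; apply/submod_predP; exact: submodZ.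
Qed.
HB.instance Definition _ :=
  GRing.isSubmodClosed.Build R V (submod_pred hP) submod_pred_closed.

Definition submod_type := {x : V | submod_pred hP x}.
HB.instance Definition _ := SubChoice.on submod_type.
HB.instance Definition _ := [SubChoice_isSubLmodule of submod_type by <:].

Definition sub_val (x : submod_type) : V := val x.

Lemma sub_val_inj : injective sub_val. Proof. exact: val_inj. Qed.

Lemma sub_valP (x : submod_type) : P (sub_val x).
Proof. exact/asboolP/(valP x). Qed.

Definition to_submod (x : V) (Px : P x) : submod_type := exist _ x (asboolT Px).

Lemma to_submodK x Px : sub_val (@to_submod x Px) = x.
Proof. by []. Qed.

Lemma sub_val_lin (t : R) x y : sub_val (t *: x + y) = t *: sub_val x + sub_val y.
Proof. by rewrite /sub_val GRing.valD GRing.valZ. Qed.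

Lemma sub_val0 : sub_val 0 = 0.
Proof.
by apply: (addIr (sub_val 0)); rewrite -[X in X + _]scale1r -sub_val_lin scaler0 !add0r.
Qed.

Lemma sub_valZ (t : R) x : sub_val (t *: x) = t *: sub_val x.
Proof. by rewrite -[t *: x]addr0 sub_val_lin sub_val0 addr0. Qed.

Lemma sub_valN x : sub_val (- x) = - sub_val x.
Proof. by rewrite -!scaleN1r sub_valZ. Qed.

End SubmoduleType.

Section SubLie.
Variables (R : realType) (V : lmodType R) (P : set V) (br : V -> V -> V).
Hypotheses (hP : submod P) (hb : forall x y, P x -> P y -> P (br x y)).
Hypothesis br_l : forall (t : R) x y z, P x -> P y -> P z ->
  br (t *: x + y) z = t *: br x z + br y z.
Hypothesis br_r : forall (t : R) x y z, P x -> P y -> P z ->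
  br z (t *: x + y) = t *: br z x + br z y.
Hypothesis br_anti : forall x y, P x -> P y -> br x y = - br y x.
Hypothesis br_jac : forall x y z, P x -> P y -> P z ->
  br x (br y z) = br (br x y) z + br y (br x z).

(** The Lie axioms are assumed on [P] only: the intended bracket is the commutator of maps [M -> M],
    which is not bilinear outside the linear maps. *)
Definition sub_br (x y : submod_type hP) : submod_type hP :=
  to_submod hP (hb (sub_valP x) (sub_valP y)).

Lemma sub_br_lie : is_lie sub_br.
Proof.
have vP := @sub_valP R V P hP.
have vL := @sub_val_lin R V P hP.
split=> [t x y z|t x y z|u v|u v w]; apply: sub_val_inj.
- by rewrite vL !to_submodK vL br_l.
- by rewrite vL !to_submodK vL br_r.
- by rewrite sub_valN !to_submodK -br_anti.
- by rewrite -[sub_br (sub_br u v) w]scale1r vL scale1r !to_submodK br_jac.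
Qed.

End SubLie.

(** * The Lie algebra of endomorphisms *)

Section Endomorphisms.
Variables (R : realType) (M : lmodType R).

Definition linear_maps : set (M -> M) := [set f | lin_on setT f].

Definition commutator (f g : M -> M) : M -> M := fun x => f (g x) - g (f x).

Lemma linear_maps_submod : submod linear_maps.
Proof.
have E0 u : (0 : M -> M) u = 0 by [].
have E t (f g : M -> M) u : (t *: f + g) u = t *: f u + g u by [].
split=> [|t f g hf hg] s x y _ _; first by rewrite !E0 scaler0 addr0.
rewrite !E hf // hg // !scalerDr addrACA; congr (_ + _ + _).
by rewrite !scalerA mulrC.
Qed.

Lemma linear_mapsB f x y : linear_maps f -> f (x - y) = f x - f y.
Proof. by move=> hf; rewrite (lin_onB (submodT M) hf). Qed.

Lemma commutator_linear f g :
  linear_maps f -> linear_maps g -> linear_maps (commutator f g).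
Proof.
move=> hf hg t x y _ _; rewrite /commutator hg // hf // hf // hg //.
by rewrite scalerBr opprD addrACA.
Qed.

Definition end_type := submod_type linear_maps_submod.

Lemma commutator_l (t : R) f g h : linear_maps f -> linear_maps g -> linear_maps h ->
  commutator (t *: f + g) h = t *: commutator f h + commutator g h.
Proof.
move=> hf hg hh; apply/funext => x.
have E (f' g' : M -> M) u : (t *: f' + g') u = t *: f' u + g' u by [].
by rewrite E /commutator E hh // scalerBr opprD addrACA.
Qed.

Lemma commutator_anti f g : commutator f g = - commutator g f.
Proof. by apply/funext => x; rewrite [RHS]opprB. Qed.

Lemma commutator_r (t : R) f g h : linear_maps f -> linear_maps g -> linear_maps h ->
  commutator h (t *: f + g) = t *: commutator h f + commutator h g.
Proof.
move=> hf hg hh; rewrite commutator_anti commutator_l // opprD -scalerN.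
by rewrite -!(commutator_anti h).
Qed.

Lemma commutator_jacobi f g h : linear_maps f -> linear_maps g -> linear_maps h ->
  commutator f (commutator g h)
  = commutator (commutator f g) h + commutator g (commutator f h).
Proof.
move=> hf hg hh; apply/funext => x.
have E (f' g' : M -> M) u : (f' + g') u = f' u + g' u by [].
rewrite E /commutator.
rewrite !(linear_mapsB _ _ hf) !(linear_mapsB _ _ hg) !(linear_mapsB _ _ hh).
rewrite [RHS]addrACA subrKA -opprD addrC [X in - X + _]addrC subrKA.
by rewrite !opprB addrC addrACA [X in _ + X]addrC addrACA.
Qed.

Definition end_br : end_type -> end_type -> end_type :=
  @sub_br R _ linear_maps commutator linear_maps_submod commutator_linear.

Lemma end_br_lie : is_lie end_br.
Proof.
apply: sub_br_lie.
- by move=> t f g h; apply: commutator_l.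
- by move=> t f g h; apply: commutator_r.
- by move=> f g _ _; apply: commutator_anti.
- by move=> f g h; apply: commutator_jacobi.
Qed.

Definition to_end (f : M -> M) (hf : linear_maps f) : end_type :=
  to_submod linear_maps_submod hf.

Lemma to_endK f hf : sub_val (@to_end f hf) = f.
Proof. by []. Qed.

Lemma end_brE f g : sub_val (end_br f g) = commutator (sub_val f) (sub_val g).
Proof. by []. Qed.

End Endomorphisms.

(** * The presentation over the reals and its action on functions of words *)

Section Presentation.
Variables (R : realType) (n : nat) (h0 : lmodType R).
Variables (beta : 'I_n -> h0 -> R^o) (gamma : 'I_n -> h0).

Record rrel (L : lmodType R) (br : L -> L -> L) (e f : 'I_n -> L) (i : h0 -> L)
    : Prop := RRel {
  rr_lin : lin_on setT i;
  rr_ef : forall j k, br (e j) (f k) = if j == k then i (gamma j) else 0;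
  rr_hh : forall h h', br (i h) (i h') = 0;
  rr_he : forall h j, br (i h) (e j) = beta j h *: e j;
  rr_hf : forall h j, br (i h) (f j) = - (beta j h *: f j)
}.

(** Uniqueness concerns maps whose values on the generators solve the relations, which is the form
    that unique existence in [is_eta] delivers. *)
Record presented (L : lmodType R) (br : L -> L -> L) (e f : 'I_n -> L)
    (i : h0 -> L) : Prop := Presented {
  pr_rel : rrel br e f i;
  pr_ex : forall (K : lmodType R) (brK : K -> K -> K), is_lie brK ->
    forall e' f' i', rrel brK e' f' i' ->
    exists phi : L -> K, [/\ lhom_on br brK setT phi, forall j, phi (e j) = e' j,
      forall j, phi (f j) = f' j & forall h, phi (i h) = i' h];
  pr_uniq : forall (K : lmodType R) (brK : K -> K -> K), is_lie brK ->
    forall e' f' i', rrel brK e' f' i' ->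
    forall phi psi : L -> K, lhom_on br brK setT phi -> lhom_on br brK setT psi ->
    (forall j, phi (e j) = psi (e j)) -> (forall j, phi (f j) = psi (f j)) ->
    (forall h, phi (i h) = psi (i h)) -> (forall j, phi (e j) = e' j) ->
    (forall j, phi (f j) = f' j) -> (forall h, phi (i h) = i' h) -> phi =1 psi
}.

Hypothesis beta_lin : forall j, lin_on setT (beta j).

Section WordModule.
Variables (N : lmodType R) (lam : h0 -> R^o).
Hypothesis lam_lin : lin_on setT lam.
Local Notation M := (seq 'I_n -> N).
Definition word_module : lmodType R := (seq 'I_n -> N)%type.

Definition wt (w : seq 'I_n) (h : h0) : R := \sum_(j <- w) beta j h.

(* The transpose of the action on the tensor algebra with basis v_1, ..., v_n in
   which f_j is left multiplication by v_j and e_i kills the vacuum, which has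
   weight lam; coefficients are taken in an arbitrary space N. *)
Definition word_F (j : 'I_n) (a : M) : M := fun w => - a (j :: w).

Definition word_H (h : h0) (a : M) : M := fun w => (wt w h - lam h) *: a w.

(** The transpose, up to sign, of [e_i v_j w' = v_j e_i w' + delta_ij (lam - wt w')(gamma_i) w'].
    Removing a letter replaces [a] by its shift, so [a] varies along the recursion. *)
Fixpoint word_E_rec (i : 'I_n) (w : seq 'I_n) (a : M) {struct w} : N :=
  if w is j :: w' then
    (if i == j then (wt w' (gamma i) - lam (gamma i)) *: a w' else 0)
      + word_E_rec i w' (fun u => a (j :: u))
  else 0.

Definition word_E (i : 'I_n) (a : M) : M := fun w => word_E_rec i w a.

Lemma wt_cons j w h : wt (j :: w) h = beta j h + wt w h.
Proof. by rewrite /wt big_cons. Qed.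

Lemma fct_lin (t : R) (a b : M) w : (t *: a + b) w = t *: a w + b w.
Proof. by []. Qed.

Lemma word_F_lin j : linear_maps (word_F j).
Proof.
by move=> t a b _ _; apply/funext => w; rewrite fct_lin /word_F fct_lin opprD scalerN.
Qed.

Lemma word_H_lin h : linear_maps (word_H h).
Proof.
move=> t a b _ _; apply/funext => w; rewrite fct_lin /word_H fct_lin scalerDr.
by rewrite !scalerA mulrC.
Qed.

Lemma word_E_rec_lin i w (t : R) (a b : M) :
  word_E_rec i w (fun u => t *: a u + b u)
  = t *: word_E_rec i w a + word_E_rec i w b.
Proof.
elim: w a b => [|j w IH] a b /=; first by rewrite scaler0 addr0.
rewrite (IH (fun u => a (j :: u)) (fun u => b (j :: u))).
rewrite [in RHS]scalerDr [RHS]addrACA; congr (_ + _); case: ifP => _.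
  by rewrite scalerDr !scalerA mulrC.
by rewrite scaler0 addr0.
Qed.

Lemma word_E_lin i : linear_maps (word_E i).
Proof. by move=> t a b _ _; apply/funext => w; apply: word_E_rec_lin. Qed.

Lemma word_E_recZ i w (t : R) (a : M) :
  word_E_rec i w (fun u => t *: a u) = t *: word_E_rec i w a.
Proof.
have e0 : word_E_rec i w (fun=> 0) = 0.
  elim: w => [|j w IH] //=; rewrite IH addr0.
  by case: ifP => _; rewrite ?scaler0.
have := word_E_rec_lin i w t a (fun=> 0); rewrite e0 addr0 => <-.
by congr word_E_rec; apply/funext => u; rewrite addr0.
Qed.

(** The recursion of [word_E] was made for this relation: the term with the shifted function occurs
    twice with opposite signs, and the [delta_ij] term is left. *)
Lemma word_EF i j :
  commutator (word_E i) (word_F j) = if i == j then word_H (gamma i) else 0.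
Proof.
apply/funext => a; apply/funext => w.
rewrite -[LHS]/(word_E i (word_F j a) w - word_F j (word_E i a) w).
rewrite /word_F /word_E /= opprK.
have -> : word_E_rec i w (fun u => - a (j :: u))
          = - word_E_rec i w (fun u => a (j :: u)).
  rewrite -scaleN1r -word_E_recZ; congr word_E_rec; apply/funext => u.
  by rewrite scaleN1r.
by rewrite addrCA addNr addr0; case: eqP.
Qed.

Lemma word_HH h h' : commutator (word_H h) (word_H h') = 0.
Proof.
apply/funext => a; apply/funext => w.
rewrite -[LHS]/(word_H h (word_H h' a) w - word_H h' (word_H h a) w).
by rewrite /word_H !scalerA mulrC subrr.
Qed.

Lemma word_HF h j : commutator (word_H h) (word_F j) = - (beta j h *: word_F j).
Proof.
apply/funext => a; apply/funext => w.
rewrite -[LHS]/(word_H h (word_F j a) w - word_F j (word_H h a) w).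
rewrite -[RHS]/(- (beta j h *: - a (j :: w))) /word_H /word_F opprK scalerN.
by rewrite !scalerN !opprK addrC -scalerBl wt_cons -[_ + _ - lam h]addrA addrK.
Qed.

Lemma word_HE h i : commutator (word_H h) (word_E i) = beta i h *: word_E i.
Proof.
apply/funext => a; apply/funext => w.
rewrite -[LHS]/(word_H h (word_E i a) w - word_E i (word_H h a) w).
rewrite -[RHS]/(beta i h *: word_E_rec i w a) /word_H /word_E.
elim: w a => [|j w IH] a /=; first by rewrite !scaler0 subrr.
have -> : (fun u => (wt (j :: u) h - lam h) *: a (j :: u)) =
    (fun u => beta j h *: a (j :: u) + (wt u h - lam h) *: a (j :: u)).
  by apply/funext => u; rewrite wt_cons -addrA scalerDl.
rewrite (word_E_rec_lin i w (beta j h) (fun u => a (j :: u))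
  (fun u => (wt u h - lam h) *: a (j :: u))).
(* The induction hypothesis for the shifted function, solved for its second term. *)
have -> : word_E_rec i w (fun u => (wt u h - lam h) *: a (j :: u)) =
    (wt w h - lam h) *: word_E_rec i w (fun u => a (j :: u))
    - beta i h *: word_E_rec i w (fun u => a (j :: u)).
  by rewrite -(IH (fun u => a (j :: u))) opprB addrC subrK.
rewrite wt_cons -[_ + _ - lam h]addrA.
move: (wt w h - lam h) (word_E_rec i w _) => c Ea.
case: eqP => [<-|_].
  rewrite scalerDl [c *: (_ + _)]scalerDr [beta i h *: Ea + _]addrCA subrr addr0.
  have cC g (x : N) : g *: (c *: x) = c *: (g *: x) by rewrite !scalerA mulrC.
  by rewrite cC addrK.
by rewrite !add0r addrA -scalerDl opprB [LHS]addrC subrK.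
Qed.

Lemma word_rrel :
  rrel (@end_br R word_module) (fun j => to_end (word_E_lin j))
    (fun j => to_end (word_F_lin j)) (fun h => to_end (word_H_lin h)).
Proof.
split.
- move=> t u v _ _; apply: sub_val_inj; rewrite sub_val_lin !to_endK.
  apply/funext => a; apply/funext => w.
  rewrite -[RHS]/(t *: word_H u a w + word_H v a w) /word_H.
  have -> : wt w (t *: u + v) = t * wt w u + wt w v.
    rewrite /wt mulr_sumr -big_split; apply: eq_bigr => j _.
    by rewrite beta_lin.
  rewrite lam_lin // scalerA -scalerDl; congr (_ *: _).
  by rewrite mulrBr opprD addrACA.
- move=> j k; apply: sub_val_inj; rewrite end_brE !to_endK word_EF.
  by case: eqP; rewrite ?sub_val0.
- by move=> h h'; apply: sub_val_inj; rewrite end_brE !to_endK word_HH sub_val0.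
- by move=> h j; apply: sub_val_inj; rewrite end_brE sub_valZ !to_endK word_HE.
- move=> h j; apply: sub_val_inj.
  by rewrite end_brE sub_valN sub_valZ !to_endK word_HF.
Qed.

Lemma word_action (L : lmodType R) (br : L -> L -> L) e f i :
  presented br e f i -> exists rho : L -> word_module -> word_module,
  [/\ forall x, linear_maps (rho x), lin_on setT rho,
      forall x y, rho (br x y) = commutator (rho x) (rho y)
    & [/\ forall j, rho (e j) = word_E j, forall j, rho (f j) = word_F j
        & forall h, rho (i h) = word_H h]].
Proof.
move=> [_ pex _].
have [phi [[pl pb] pe pf pi]] := pex _ _ (@end_br_lie R word_module) _ _ _ word_rrel.
exists (fun x => sub_val (phi x)); split.
- by move=> x; apply: sub_valP.
- by move=> t x y _ _; rewrite pl // sub_val_lin.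
- by move=> x y; rewrite pb.
- by split=> j; rewrite ?pe ?pf ?pi.
Qed.

End WordModule.
End Presentation.

(** * Freeness of eta_- through the loop module *)

Section Coinduction.
Variables (R : realType) (n : nat) (h0 : lmodType R).
Variables (beta : 'I_n -> h0 -> R^o) (gamma : 'I_n -> h0).
Hypothesis beta_lin : forall j, lin_on setT (beta j).
Variables (L : lmodType R) (br : L -> L -> L) (e f : 'I_n -> L) (i : h0 -> L).
Hypotheses (lie : is_lie br) (pres : presented beta gamma br e f i).
Variables (K : lmodType R) (brK : K -> K -> K) (lieK : is_lie brK) (y : 'I_n -> K).
Variables (lam : h0 -> R^o) (lam_lin : lin_on setT lam).

(* K[[t, 1/t]] + R D with D = t d/dt, so that [v t^d, D] = - d v t^d. *)
Definition loopD : lmodType R := ((int -> K) * R^o)%type.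

(** The bracket with [v t^d]. Series infinite in both directions have no bracket with each other,
    but a monomial only shifts them, so each coefficient is a single bracket; [D] contributes only
    in degree [d]. *)
Definition loop_ad (d : nat) (v : K) (x : loopD) : loopD :=
  (fun m => brK v (x.1 (m - d%:Z)) - (if m == d%:Z then (x.2 * d%:R) *: v else 0), 0).

Lemma loopD_eq (a b : loopD) : a.1 =1 b.1 -> a.2 = b.2 -> a = b.
Proof. by case: a b => [a1 a2] [b1 b2] /= /funext -> ->. Qed.

Lemma loopD_lin1 t (a b : loopD) m : (t *: a + b).1 m = t *: a.1 m + b.1 m.
Proof. by []. Qed.

Lemma loopD_lin2 t (a b : loopD) : (t *: a + b).2 = t * a.2 + b.2.
Proof. by []. Qed.

Lemma loopD_B (a b : loopD) m : (a - b).1 m = a.1 m - b.1 m.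
Proof. by []. Qed.

Lemma loop_ad1 d v x m : (loop_ad d v x).1 m
  = brK v (x.1 (m - d%:Z)) - (if m == d%:Z then (x.2 * d%:R) *: v else 0).
Proof. by []. Qed.

Lemma loop_ad2 d v x : (loop_ad d v x).2 = 0. Proof. by []. Qed.

Lemma loop_ad_lin d v t x x' :
  loop_ad d v (t *: x + x') = t *: loop_ad d v x + loop_ad d v x'.
Proof.
apply: loopD_eq => [m|]; last by rewrite loopD_lin2 !loop_ad2 mulr0 addr0.
rewrite loopD_lin1 !loop_ad1 loopD_lin1 loopD_lin2 il_r //.
rewrite scalerBr addrACA -opprD; congr (_ - _); case: ifP => _.
  by rewrite scalerA -scalerDl mulrDl mulrA.
by rewrite scaler0 addr0.
Qed.

Lemma loop_ad_linv d v v' t x :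
  loop_ad d (t *: v + v') x = t *: loop_ad d v x + loop_ad d v' x.
Proof.
apply: loopD_eq => [m|]; last by rewrite loopD_lin2 !loop_ad2 mulr0 addr0.
rewrite loopD_lin1 !loop_ad1 il_l // scalerBr addrACA -opprD; congr (_ - _).
case: ifP => _; last by rewrite scaler0 addr0.
by rewrite scalerDr !scalerA mulrC.
Qed.

(** On series this is the Jacobi identity of [K]. On [D] it is the Leibniz rule: the factor [d + d']
    splits into the contributions of the two monomials. *)
Lemma loop_ad_br d d' v v' x :
  loop_ad (d + d') (brK v v') x
  = loop_ad d v (loop_ad d' v' x) - loop_ad d' v' (loop_ad d v x).
Proof.
apply: loopD_eq => [m|]; last by rewrite /= subr0.
rewrite loopD_B !loop_ad1 !loop_ad2 !mul0r !scale0r !if_same !subr0.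
rewrite !(brDr lieK) !(brNr lieK).
have -> : m - d%:Z - d'%:Z = m - (d + d')%N%:Z by rewrite PoszD opprD addrA.
have -> : m - d'%:Z - d%:Z = m - (d + d')%N%:Z.
  by rewrite PoszD opprD addrA addrAC.
have -> : (m - d%:Z == d'%:Z) = (m == (d + d')%N%:Z).
  by rewrite subr_eq PoszD [d'%:Z + _]addrC.
have -> : (m - d'%:Z == d%:Z) = (m == (d + d')%N%:Z) by rewrite subr_eq PoszD.
set Z := if _ then _ else 0.
set Y1 := if _ then _ else 0.
set Y2 := if _ then _ else 0.
have -> : Z = brK v Y1 - brK v' Y2.
  rewrite /Z /Y1 /Y2; case: ifP => _; last by rewrite !(br0r lieK) subr0.
  rewrite !(brZr lieK) (il_anti lieK v' v) scalerN opprK -scalerDl natrD mulrDr.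
  by rewrite addrC.
rewrite (il_jac lieK v v') !opprB [_ + brK v' (brK v _) - _]addrAC.
by rewrite [RHS]addrACA subrr addr0 [in RHS]addrAC addrA.
Qed.

Local Notation y1 j := (loop_ad 1 (y j)).

(* The restriction to eta_- of the word module with coefficients in [loopD]
   contains [loopD], on which f_j acts as [y_j t, -]. *)
Fixpoint embed_rec (x : loopD) (w : seq 'I_n) : loopD :=
  if w is j :: w' then embed_rec (- y1 j x) w' else x.

Definition embed (x : loopD) : word_module n loopD := embed_rec x.

Lemma embed_lin t x x' : embed (t *: x + x') = t *: embed x + embed x'.
Proof.
apply/funext => w; rewrite fct_lin /embed.
elim: w x x' => [|j w IH] x x' //=; rewrite -IH; congr embed_rec.
by rewrite loop_ad_lin opprD scalerN.
Qed.

Lemma embedZ t x : embed (t *: x) = t *: embed x.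
Proof.
have e0 : embed 0 = 0.
  apply: (addIr (embed 0)); rewrite -[X in X + _]scale1r -embed_lin.
  by rewrite scaler0 !add0r.
by rewrite -[_ *: x]addr0 embed_lin e0 addr0.
Qed.

Lemma embedN x : embed (- x) = - embed x.
Proof. by rewrite -!scaleN1r embedZ. Qed.

Lemma embedB x x' : embed (x - x') = embed x - embed x'.
Proof. by rewrite addrC -scaleN1r embed_lin scaleN1r addrC. Qed.

Lemma embed0 : embed 0 = 0.
Proof. by rewrite -(scale0r (0 : loopD)) embedZ scale0r. Qed.

(** [embed x] at a word is the result of letting its letters act on [x], each with a minus sign;
    these signs cancel the one in [word_F], so the embedding intertwines both actions. *)
Lemma word_F_embed j x : word_F j (embed x) = embed (y1 j x).
Proof.
apply/funext => w; rewrite -[LHS]/(- embed (- y1 j x) w) embedN.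
exact: opprK.
Qed.

Section Action.
Variable rho : L -> word_module n loopD -> word_module n loopD.
Hypothesis rhoL : lin_on setT rho.
Hypothesis rho_br : forall z z', rho (br z z') = commutator (rho z) (rho z').
Hypothesis rho_f : forall j, rho (f j) = @word_F R n loopD j.

Definition homog (d : nat) (z : L) (v : K) : Prop :=
  forall x, rho z (embed x) = embed (loop_ad d v x).

Lemma homog_f j : homog 1 (f j) (y j).
Proof. by move=> x; rewrite rho_f word_F_embed. Qed.

Lemma homog_br d d' z z' v v' : homog d z v -> homog d' z' v' ->
  homog (d + d') (br z z') (brK v v').
Proof.
move=> h h' x; rewrite rho_br /commutator h h' h h' loop_ad_br.
by rewrite embedB.
Qed.

Lemma homog_lin d t z z' v v' : homog d z v -> homog d z' v' ->
  homog d (t *: z + z') (t *: v + v').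
Proof.
move=> h h' x; rewrite rhoL // loop_ad_linv embed_lin -h -h'; by [].
Qed.

(* [matches z v]: z acts on [loopD] through some V(t) in t K[t] with V(1) = v. The
   image of D is - t V'(t), so that z determines v. *)
Inductive matches : L -> K -> Prop :=
| matches_homog d z v : homog d.+1 z v -> matches z v
| matches_add z z' v v' : matches z v -> matches z' v' -> matches (z + z') (v + v').

Lemma homog0 d : homog d 0 0.
Proof.
move=> x; rewrite (lin_on0 (submodT L) rhoL).
have -> : loop_ad d 0 x = 0; last by rewrite embed0.
by apply: loopD_eq => [m|//]; rewrite loop_ad1 (br0l lieK) scaler0 if_same subr0.
Qed.

Lemma homogZ d t z v : homog d z v -> homog d (t *: z) (t *: v).
Proof.
by move=> h; rewrite -[t *: z]addr0 -[t *: v]addr0; apply/homog_lin/homog0.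
Qed.

Lemma matchesZ t z v : matches z v -> matches (t *: z) (t *: v).
Proof.
elim=> [d {}z {}v h|z1 z2 v1 v2 _ h1 _ h2]; last by rewrite !scalerDr; apply: matches_add.
by apply: (@matches_homog d); apply: homogZ.
Qed.

Lemma matches0 : matches 0 0.
Proof. by apply: (@matches_homog 0); apply: homog0. Qed.

Lemma matches_br z z' v v' :
  matches z v -> matches z' v' -> matches (br z z') (brK v v').
Proof.
move=> h; elim: h z' v' => [d {}z {}v h|z1 z2 v1 v2 _ h1 _ h2] z' v' h'; last first.
  by rewrite (brDl lie) (brDl lieK); apply: matches_add; [exact: h1|exact: h2].
elim: h' => [d' {}z' {}v' h'|z1 z2 v1 v2 _ h1 _ h2].
  by apply: (@matches_homog (d + d'.+1)); rewrite -addSn; apply: homog_br.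
by rewrite (brDr lie) (brDr lieK); apply: matches_add.
Qed.

Lemma matches_f j : matches (f j) (y j).
Proof. by apply: (@matches_homog 0); apply: homog_f. Qed.

(** Here [(0, 1)] is [D], and evaluation at the empty word inverts [embed]. If [V] has coefficients
    [v_k], then the coefficient of [t^(k+1)] in the image of [D] is [- (k+1) v_(k+1)]; dividing by
    degrees and adding up recovers [V(1)]. Every large cutoff [m'] is allowed, so that two summands
    can be compared at a common one. *)
Lemma matches_eval z v : matches z v ->
  (rho z (embed (0, 1)) [::]).2 = 0 /\ exists m, forall m', (m <= m')%N ->
    v = - \sum_(k < m') k.+1%:R^-1 *: (rho z (embed (0, 1)) [::]).1 k.+1%:Z.
Proof.
elim=> [d {}z {}v h|z1 z2 v1 v2 _ [h1 [m1 e1]] _ [h2 [m2 e2]]].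
  rewrite h; split=> //; exists d.+1 => m' dm.
  rewrite (bigD1 (Ordinal dm)) //= big1 => [|k kd].
    rewrite eqxx (br0r lieK) mul1r sub0r scalerN scalerA mulVf ?pnatr_eq0 //.
    by rewrite scale1r addr0 opprK.
  by rewrite (br0r lieK) sub0r ifN ?oppr0 ?scaler0 //.
rewrite (lin_onD rhoL) //; split.
  by rewrite -[LHS]/((rho z1 (embed (0, 1)) [::]).2 + (rho z2 (embed (0, 1)) [::]).2) h1 h2 addr0.
exists (maxn m1 m2) => m'; rewrite geq_max => /andP[h1' h2'].
rewrite {1}(e1 _ h1') {1}(e2 _ h2') -opprD -big_split; congr (- _).
by apply: eq_bigr => k _; rewrite [RHS]scalerDr.
Qed.

Lemma matches_eq0 z v : matches z v ->
  (forall m, (rho z (embed (0, 1)) [::]).1 m = 0) -> v = 0.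
Proof.
move=> /matches_eval [_ [m /(_ _ (leqnn m)) ->]] h.
by rewrite big1 ?oppr0 // => k _; rewrite h scaler0.
Qed.

Lemma matches_fun z v v' : matches z v -> matches z v' -> v = v'.
Proof.
move=> h /(matchesZ (-1)) h'; apply/eqP; rewrite -subr_eq0; apply/eqP.
apply: (matches_eq0 (z := 0)).
  by have := matches_add h h'; rewrite !scaleN1r subrr.
by rewrite (lin_on0 (submodT L) rhoL).
Qed.

Lemma matches_lgen z : lgen br (range f) z -> exists v, matches z v.
Proof.
move=> hz; apply: (hz [set a | exists v, matches a v]); last first.
  by move=> _ [j _ <-]; exists (y j); apply: matches_f.
split; first split; first by exists 0; apply: matches0.
  move=> t a b [v h] [v' h']; exists (t *: v + v').
  by apply: matches_add => //; apply: matchesZ.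
by move=> a b [v h] [v' h']; exists (brK v v'); apply: matches_br.
Qed.

End Action.

(** [matches] is the graph of the homomorphism: it is total on [eta_-], single valued, and closed
    under linear combinations and brackets. *)
Lemma lgen_f_free : exists phi : L -> K,
  lhom_on br brK (lgen br (range f)) phi /\ forall j, phi (f j) = y j.
Proof.
have [rho [rho_lin rhoL rho_br [_ rho_f _]]] :=
  word_action beta_lin loopD lam_lin pres.
pose phi z := xget 0 [set v | matches rho z v].
have phiP z : lgen br (range f) z -> matches rho z (phi z).
  by move=> /(matches_lgen rhoL rho_br rho_f) [v hv]; apply: (@xgetI _ 0 _ v).
have phiE z v : matches rho z v -> phi z = v.
  by move=> hv; apply: (matches_fun rhoL) (hv); apply: (@xgetI _ 0 _ v).
exists phi; split; last by move=> j; apply/phiE/matches_f.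
split=> [t a b ha hb|a b ha hb]; apply: phiE.
  by apply: matches_add; [apply: matchesZ => //|]; exact: phiP.
by apply: matches_br => //; exact: phiP.
Qed.

End Coinduction.

(** * Stability under generated subalgebras, right-normed brackets *)

Section LieGeneralities.
Variables (R : realType) (L : lmodType R) (br : L -> L -> L).
Hypothesis lie : is_lie br.

Lemma normalizer_lsub (P : set L) : submod P ->
  lsub br [set u | forall v, P v -> P (br u v)].
Proof.
move=> hP; split; first split.
- by move=> v _; rewrite (br0l lie); case: hP.
- move=> t u u' hu hu' v Pv; rewrite (il_l lie).
  by case: hP => _; apply; [exact: hu|exact: hu'].
- move=> u u' hu hu' v Pv.
  have -> : br (br u u') v = br u (br u' v) - br u' (br u v).
    by rewrite (il_jac lie) addrK.
  by apply: submodB => //; [apply/hu/hu'|apply/hu'/hu].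
Qed.

(** The elements that map [P] into itself form a subalgebra, by the Jacobi identity, so testing
    generators suffices. *)
Lemma lgen_stable (S P : set L) u v : submod P ->
  (forall s w, S s -> P w -> P (br s w)) -> lgen br S u -> P v -> P (br u v).
Proof.
move=> hP hS hu; apply: (hu [set u | forall v, P v -> P (br u v)]) => {v}.
  exact: normalizer_lsub.
by move=> s Ss v; apply: hS.
Qed.

Variables (n : nat) (x : 'I_n -> L).

(* The pair (w, j) stands for the nonempty word [rcons w j]. *)
Definition rnorm (p : seq 'I_n * 'I_n) : L := foldr (fun k => br (x k)) (x p.2) p.1.

Definition rspan : set L := [set u | exists l : seq (R * (seq 'I_n * 'I_n)),
  u = \sum_(p <- l) p.1 *: rnorm p.2].

Lemma rspan_submod : submod rspan.
Proof.
split=> [|t u v [l ->] [l' ->]]; first by exists [::]; rewrite big_nil.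
exists ([seq (t * p.1, p.2) | p <- l] ++ l'); rewrite big_cat big_map /=.
by rewrite scaler_sumr; congr (_ + _); apply: eq_bigr => p _; rewrite scalerA.
Qed.

Lemma rspan_br j u : rspan u -> rspan (br (x j) u).
Proof.
case=> l ->; exists [seq (p.1, (j :: p.2.1, p.2.2)) | p <- l].
by rewrite big_map (br_sumr lie); apply: eq_bigr => p _; rewrite (brZr lie).
Qed.

Lemma lgen_rnorm p : lgen br (range x) (rnorm p).
Proof.
case: p => w j; elim: w => [|k w IH]; first by apply: sub_lgen; exists j.
by apply: (proj2 (lsub_lgen br (range x))) => //; apply: sub_lgen; exists k.
Qed.

Lemma lgen_rspan u : lgen br (range x) u -> rspan u.
Proof.
move=> hu; apply: (proj1 (A := rspan u) (B := lgen br (range x) u)).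
(* The span alone is only known to be stable under the generators. Intersecting with the generated
   subalgebra keeps the left factor of a bracket within reach of [lgen_stable]. *)
apply: (hu (rspan `&` lgen br (range x))); last first.
  move=> _ [j _ <-]; split; last by apply: sub_lgen; exists j.
  by exists [:: (1, ([::], j))]; rewrite big_seq1 scale1r.
have sl := lsub_lgen br (range x); split; first split.
- by split; [case: rspan_submod|case: sl => -[]].
- move=> t a b [ha ga] [hb gb]; split; first by case: rspan_submod => _; apply.
  by case: sl => -[_ h] _; apply: h.
move=> a b [ha ga] [hb gb]; split; last by apply: (proj2 sl).
apply: (lgen_stable (S := range x)) => //; first exact: rspan_submod.
by move=> _ w [j _ <-]; apply: rspan_br.
Qed.

End LieGeneralities.

Lemma sum_by_fst (B : eqType) (V : zmodType) (l : seq (B * V)) (s : seq B) :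
  uniq s -> (forall p, p \in l -> p.1 \in s) ->
  \sum_(p <- l) p.2 = \sum_(b <- s) \sum_(p <- l | p.1 == b) p.2.
Proof.
move=> us ls.
rewrite (eq_bigr (fun b => \sum_(p <- l) if p.1 == b then p.2 else 0)) => [|b' _];
  last by rewrite big_mkcond.
rewrite exchange_big big_seq [RHS]big_seq; apply: eq_bigr => p pl.
rewrite -big_mkcond -big_filter (eq_filter (a2 := pred1 p.1)); last by move=> b';
  rewrite /= eq_sym.
by rewrite filter_pred1_uniq ?ls // big_seq1.
Qed.

(** * Weight spaces and independence of weights *)

Section Weights.
Variables (R : realType) (L : lmodType R) (br : L -> L -> L).
Hypothesis lie : is_lie br.
Variables (h0 : lmodType R) (i : h0 -> L).

Definition weight_space (b : h0 -> R) : set L :=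
  [set u | forall h, br (i h) u = b h *: u].

Lemma weight_space_submod b : submod (weight_space b).
Proof.
split=> [h|t u v hu hv h]; first by rewrite (br0r lie) scaler0.
by rewrite (il_r lie) hu hv scalerDr !scalerA mulrC.
Qed.

Section UniqSep.
Variables (I : set L) (hI : submod I) (I_stable : forall h u, I u -> I (br (i h) u)).

(** Induction on the number of weights. The operator [ad h - b0 h] kills the component of weight
    [b0] and multiplies that of weight [b] by [b h - b0 h], which is nonzero for some [h] since the
    two weights are different functions. *)
Lemma uniq_weights_sum (s : seq (h0 -> R)) (X : (h0 -> R) -> L) :
  uniq s -> (forall b, b \in s -> weight_space b (X b)) ->
  I (\sum_(b <- s) X b) -> forall b, b \in s -> I (X b).
Proof.
elim: s X => [|b0 s IH] X //= /andP[b0s us] hX hs.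
have hs' b : b \in s -> I (X b).
  move=> bs; have [h bh] : exists h, b h != b0 h.
    apply: contrapT => E; case/negP: b0s.
    suff -> : b0 = b by [].
    apply/funext => h; apply/eqP; apply: contrapT => /negP hb.
    by apply: E; exists h; rewrite eq_sym.
  have := IH (fun b => (b h - b0 h) *: X b) us _ _ _ bs.
  move=> Ib; rewrite -[X b]scale1r -(mulVf (x := b h - b0 h)) ?subr_eq0 //.
  rewrite -scalerA; apply: submodZ => //; apply: Ib => [b' b's|].
    apply: (submodZ _ (weight_space_submod b')).
    by apply: hX; rewrite in_cons b's orbT.
  have -> : \sum_(b <- s) (b h - b0 h) *: X b =
      br (i h) (\sum_(b <- b0 :: s) X b) - b0 h *: \sum_(b <- b0 :: s) X b.
    rewrite (br_sumr lie) scaler_sumr -sumrB big_cons.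
    rewrite hX ?mem_head // subrr add0r big_seq [in RHS]big_seq.
    by apply: eq_bigr => b' b's; rewrite hX ?in_cons ?b's ?orbT // scalerBl.
  by apply: submodB => //; [apply: I_stable|apply: submodZ].
move=> b; rewrite in_cons => /orP[/eqP->|]; last exact: hs'.
have -> : X b0 = \sum_(b <- b0 :: s) X b - \sum_(b <- s) X b.
  by rewrite big_cons addrK.
by apply: submodB => //; rewrite big_seq; apply: submod_sum => // b' /hs'.
Qed.

(** Terms of equal weight are merged before the weights are separated. With [I = {0}] this says that
    the sum of the weight spaces is direct. *)
Lemma weights_sum (l : seq ((h0 -> R) * L)) :
  (forall p, p \in l -> weight_space p.1 p.2) -> I (\sum_(p <- l) p.2) ->
  forall b, I (\sum_(p <- l | p.1 == b) p.2).
Proof.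
move=> hl hs b.
have [bl|bl] := boolP (b \in undup (map fst l)); last first.
  rewrite big1_seq; first by case: hI.
  move=> p /andP[/eqP pb pl]; case/negP: bl.
  by rewrite mem_undup -pb map_f.
pose X b := \sum_(p <- l | p.1 == b) p.2.
apply: (uniq_weights_sum (X := X) (undup_uniq _) _ _ bl) => [b' _|].
  rewrite /X big_seq_cond; apply: (submod_sum _ (weight_space_submod b')).
  by move=> p /andP[pl /eqP <-]; apply: hl.
rewrite /X -sum_by_fst ?undup_uniq // => p pl.
by rewrite mem_undup map_f.
Qed.

End UniqSep.

Variables (n : nat) (x : 'I_n -> L) (c : 'I_n -> h0 -> R).
Hypothesis xw : forall j, weight_space (c j) (x j).

Definition rwt (p : seq 'I_n * 'I_n) (h : h0) : R := \sum_(j <- rcons p.1 p.2) c j h.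

Lemma weight_space_br b b' u v : weight_space b u -> weight_space b' v ->
  weight_space (fun h => b h + b' h) (br u v).
Proof.
move=> hu hv h; rewrite (il_jac lie) hu hv (brZl lie) (brZr lie).
by rewrite -scalerDl.
Qed.

Lemma rnorm_weight p : weight_space (rwt p) (rnorm br x p).
Proof.
case: p => w j; elim: w => [|k w IH] h.
  by rewrite /rwt /= big_seq1; apply: xw.
rewrite /rwt big_cons -[rnorm br x _]/(br (x k) (rnorm br x (w, j))).
exact: (weight_space_br (xw k) IH).
Qed.

Lemma lgen_weight_stable h u : lgen br (range x) u -> lgen br (range x) (br (i h) u).
Proof.
move=> /(lgen_rspan lie) [l ->]; have hs := lsub_lgen br (range x).
rewrite (br_sumr lie); apply: (submod_sum _ (proj1 hs)) => p _.
rewrite (brZr lie) rnorm_weight; do 2!apply: (submodZ _ (proj1 hs)).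
exact: lgen_rnorm.
Qed.

End Weights.

(** * The symmetry between the e_j and the f_j *)

Section Halves.
Variables (R : realType) (n : nat) (h0 : lmodType R).
Variables (beta : 'I_n -> h0 -> R^o) (gamma : 'I_n -> h0).

(* The Chevalley involution e_j -> - f_j, f_j -> - e_j, h -> - h on generators. *)
Lemma rrel_swap (K : lmodType R) (brK : K -> K -> K) (lieK : is_lie brK)
    (e f : 'I_n -> K) (i : h0 -> K) : rrel beta gamma brK e f i ->
  rrel beta gamma brK (fun j => - f j) (fun j => - e j) (fun h => - i h).
Proof.
move=> rel; split=> [t u v _ _|j k|h h'|h j|h j].
- by rewrite (rr_lin rel) // opprD scalerN.
- rewrite (brNl lieK) (brNr lieK) opprK (il_anti lieK) (rr_ef rel) eq_sym.
  by case: eqP => [->|_] //; rewrite oppr0.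
- by rewrite (brNl lieK) (brNr lieK) (rr_hh rel) !oppr0.
- by rewrite (brNl lieK) (brNr lieK) opprK (rr_hf rel) scalerN.
- by rewrite (brNl lieK) (brNr lieK) opprK (rr_he rel) scalerN opprK.
Qed.

Variables (L : lmodType R) (br : L -> L -> L).
Hypothesis lie : is_lie br.

Lemma lgen_opp (x : 'I_n -> L) : lgen br (range (fun j => - x j)) = lgen br (range x).
Proof.
have h (y : 'I_n -> L) : lgen br (range y) `<=` lgen br (range (fun j => - y j)).
  move=> u hu; apply: hu; first exact: lsub_lgen.
  move=> _ [j _ <-]; rewrite -[y j]opprK.
  apply: (submodN (proj1 (lsub_lgen br _))); apply: sub_lgen; exists j => //.
rewrite eqEsubset; split=> //.
have {2}-> : x = (fun j => - - x j) by apply/funext => j; rewrite opprK.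
exact: h.
Qed.

Section Rel.
Variables (e f : 'I_n -> L) (i : h0 -> L).
Hypothesis rel : rrel beta gamma br e f i.

Lemma weight_e j : weight_space br i (beta j) (e j).
Proof. by move=> h; rewrite (rr_he rel). Qed.

Lemma weight_f j : weight_space br i (fun h => - beta j h) (f j).
Proof. by move=> h; rewrite (rr_hf rel) scaleNr. Qed.

Lemma i_lin0 : i 0 = 0.
Proof. exact: (lin_on0 (submodT h0) (rr_lin rel)). Qed.

(** [[e_j, -]] is a derivation that sends each [f_k] into [h], and [eta_-] is stable under [ad h].
    [Q] also records membership in [eta_-], which the induction needs for brackets; on these the [h]
    component is 0. *)
Lemma e_on_minus j u : lgen br (range f) u ->
  exists xm h, lgen br (range f) xm /\ br (e j) u = xm + i h.
Proof.
have hs := lsub_lgen br (range f); have wf := lgen_weight_stable lie weight_f.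
pose Q := [set v | lgen br (range f) v /\
  exists xm h, lgen br (range f) xm /\ br (e j) v = xm + i h].
suff sub : lsub br Q.
  move=> hu; have [] // := hu Q sub; move=> _ [k _ <-]; split.
    by apply: sub_lgen; exists k.
  rewrite (rr_ef rel); exists 0; case: eqP => _.
    by exists (gamma j); split; [case: hs => -[]|rewrite add0r].
  by exists 0; split; [case: hs => -[]|rewrite add0r i_lin0].
split; first split.
- split; first by case: hs => -[].
  by exists 0, 0; rewrite (br0r lie) add0r i_lin0; split=> //; case: hs => -[].
- move=> t a b [ha [xa [ka [hxa ea]]]] [hb [xb [kb [hxb eb]]]].
  split; first by case: hs => -[_ h] _; apply: h.
  exists (t *: xa + xb), (t *: ka + kb); split; first by case: hs => -[_ h] _; apply: h.
  by rewrite (il_r lie) ea eb (rr_lin rel) // scalerDr addrACA.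
move=> a b [ha [xa [ka [hxa ea]]]] [hb [xb [kb [hxb eb]]]].
split; first exact: (proj2 hs).
exists (br (br (e j) a) b + br a (br (e j) b)), 0.
rewrite i_lin0 addr0; split; last by rewrite (il_jac lie).
rewrite ea eb (brDl lie) (brDr lie) [br a (i kb)](il_anti lie).
apply: (submodD (proj1 hs)); apply: (submodD (proj1 hs)).
- exact: (proj2 hs).
- exact: wf.
- exact: (proj2 hs).
- by apply: (submodN (proj1 hs)); apply: wf.
Qed.

End Rel.

(** This turns results on [eta_-] into results on [eta_+] and conversely; replacing [i] by [- i]
    also exchanges positive and negative weights. *)
Lemma presented_swap (e f : 'I_n -> L) (i : h0 -> L) :
  presented beta gamma br e f i ->
  presented beta gamma br (fun j => - f j) (fun j => - e j) (fun h => - i h).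
Proof.
have oppE (K : lmodType R) (brK : K -> K -> K) (phi : L -> K) u :
    lhom_on br brK setT phi -> phi (- u) = - phi u.
  by move=> [pl _]; rewrite (lin_onN (submodT L) pl).
move=> [rel pex puni]; split; first exact: rrel_swap.
- move=> K brK lieK e' f' i' /(rrel_swap lieK) rel'.
  have [phi [hp pe pf pi]] := pex K brK lieK _ _ _ rel'.
  by exists phi; split=> // j; rewrite (oppE _ _ _ _ hp) ?pe ?pf ?pi opprK.
- move=> K brK lieK e' f' i' rel' phi psi hp hq he hf hi pe pf pi.
  have inj (u : L) : phi (- u) = psi (- u) -> phi u = psi u.
    by rewrite (oppE _ _ _ _ hp) (oppE _ _ _ _ hq) => /oppr_inj.
  have opp u v : phi (- u) = v -> phi u = - v.
    by rewrite (oppE _ _ _ _ hp) => <-; rewrite opprK.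
  apply: (puni K brK lieK (fun j => - f' j) (fun j => - e' j) (fun h => - i' h)) => //.
  + exact: rrel_swap.
  + by move=> j; apply: inj.
  + by move=> j; apply: inj.
  + by move=> h; apply: inj.
  + by move=> j; apply: opp.
  + by move=> j; apply: opp.
  + by move=> h; apply: opp.
Qed.

End Halves.

(** * The triangular decomposition over the reals *)

Section Structure.
Variables (R : realType) (n : nat) (h0 : lmodType R).
Variables (beta : 'I_n -> h0 -> R^o) (gamma : 'I_n -> h0).
Hypothesis beta_lin : forall j, lin_on setT (beta j).
Hypothesis beta_free : forall d : 'I_n -> R,
  (forall h, \sum_j d j * beta j h = 0) -> forall j, d j = 0.
Hypothesis h0_sep : forall h : h0,
  (forall lam : h0 -> R^o, lin_on setT lam -> lam h = 0) -> h = 0.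
Variables (L : lmodType R) (br : L -> L -> L).
Hypothesis lie : is_lie br.

Local Notation comb d := (fun h => \sum_j d j * beta j h).

Lemma comb_inj (d d' : 'I_n -> R) : comb d = comb d' -> d =1 d'.
Proof.
move=> E j; apply/eqP; rewrite -subr_eq0; apply/eqP.
apply: (beta_free (d := fun j => d j - d' j)) => h.
have /= e := congr1 (fun g : h0 -> R => g h) E.
rewrite (eq_bigr (fun k => d k * beta k h - d' k * beta k h)) => [|k _].
  by rewrite sumrB e subrr.
by rewrite mulrBl.
Qed.

Lemma rwtE (s : R) (p : seq 'I_n * 'I_n) :
  rwt (fun j h => s * beta j h) p
  = comb (fun j => s * (count_mem j (rcons p.1 p.2))%:R).
Proof.
apply/funext => h; rewrite /rwt; elim: (rcons _ _) => [|k w IH].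
  by rewrite big_nil big1 // => j _; rewrite mulr0 mul0r.
rewrite big_cons IH (bigD1 k) // [in RHS](bigD1 k) //= addrA; congr (_ + _).
  by rewrite eqxx natrD mulrDr mulr1 mulrDl.
by apply: eq_bigr => j /negbTE jk; rewrite eq_sym jk.
Qed.

Lemma rwt1 p : rwt beta p = comb (fun j => (count_mem j (rcons p.1 p.2))%:R).
Proof.
have -> : beta = (fun j h => 1 * beta j h :> R).
  by apply/funext => j; apply/funext => h; rewrite mul1r.
rewrite rwtE; apply/funext => h; apply: eq_bigr => j _.
by rewrite !mul1r.
Qed.

Lemma rwtN p : rwt (fun j h => - beta j h) p
  = comb (fun j => - (count_mem j (rcons p.1 p.2))%:R).
Proof.
have -> : (fun j h => - beta j h) = (fun j h => -1 * beta j h :> R).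
  by apply/funext => j; apply/funext => h; rewrite mulN1r.
rewrite rwtE; apply/funext => h; apply: eq_bigr => j _.
by rewrite mulN1r.
Qed.

(** The encoded words are nonempty, so the last letter is a coordinate at which the weight does not
    vanish. Comparing coefficients there separates negative weights from zero and from nonnegative
    ones. *)
Lemma count_last (p : seq 'I_n * 'I_n) :
  (count_mem p.2 (rcons p.1 p.2))%:R != 0 :> R.
Proof.
by rewrite pnatr_eq0 -lt0n -has_count; apply/hasP; exists p.2; rewrite ?mem_rcons ?mem_head /=.
Qed.

Lemma rwt_neq0 p : rwt beta p <> (fun=> 0).
Proof.
rewrite rwt1 => E; have := count_last p.
rewrite (comb_inj (d' := fun=> 0) (d :=
  fun j => (count_mem j (rcons p.1 p.2))%:R) _ p.2) ?eqxx // E.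
by apply/funext => h; rewrite big1 // => j _; rewrite mul0r.
Qed.

Lemma rwtN_neq0 p : rwt (fun j h => - beta j h) p <> (fun=> 0).
Proof.
rewrite rwtN => E; have := count_last p; rewrite -oppr_eq0.
rewrite (comb_inj (d' := fun=> 0) (d :=
  fun j => - (count_mem j (rcons p.1 p.2))%:R) _ p.2) ?eqxx // E.
by apply/funext => h; rewrite big1 // => j _; rewrite mul0r.
Qed.

Lemma rwtN_neq_pos p (c : 'I_n -> nat) :
  rwt (fun j h => - beta j h) p <> comb (fun j => (c j)%:R).
Proof.
rewrite rwtN => /comb_inj /(_ p.2) /eqP.
rewrite eq_sym -subr_eq0 opprK -natrD pnatr_eq0 addn_eq0 => /andP[_].
by have := count_last p; rewrite pnatr_eq0 => /negbTE ->.
Qed.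

Section Presented.
Variables (e f : 'I_n -> L) (i : h0 -> L).
Hypothesis pres : presented beta gamma br e f i.
Let rel := pr_rel pres.

Local Notation eta_p := (lgen br (range e)).
Local Notation eta_m := (lgen br (range f)).
Local Notation gens := (range e `|` range f `|` range i).

(** The universal property gives a map into the subalgebra generated by [gens]; followed by the
    inclusion it fixes the generators, hence is the identity. *)
Lemma generated u : lgen br gens u.
Proof.
have hs := lsub_lgen br gens.
pose K := submod_type (proj1 hs).
pose brK : K -> K -> K := sub_br (hP := proj1 hs) (proj2 hs).
have lieK : is_lie brK.
  apply: sub_br_lie => *; [exact: il_l|exact: il_r|exact: il_anti|exact: il_jac].
have ge j : lgen br gens (e j) by apply: sub_lgen; left; left; exists j.
have gf j : lgen br gens (f j) by apply: sub_lgen; left; right; exists j.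
have gi h : lgen br gens (i h) by apply: sub_lgen; right; exists h.
have relK : rrel beta gamma brK (fun j => to_submod (proj1 hs) (ge j))
    (fun j => to_submod (proj1 hs) (gf j)) (fun h => to_submod (proj1 hs) (gi h)).
  split=> [t h h' _ _|j k|h h'|h j|h j]; apply: sub_val_inj.
  - by rewrite sub_val_lin !to_submodK (rr_lin rel).
  - rewrite to_submodK (rr_ef rel).
    by case: eqP; rewrite ?sub_val0.
  - by rewrite to_submodK (rr_hh rel) sub_val0.
  - by rewrite sub_valZ !to_submodK (rr_he rel).
  - by rewrite sub_valN sub_valZ !to_submodK (rr_hf rel).
have [phi [[pl pb] pe pf pi]] := pr_ex pres lieK relK.
have /(_ u) <- : (fun v => sub_val (phi v)) =1 id; last exact: sub_valP.
apply: (pr_uniq pres lie rel) => // [|j|j|h|j|j|h]; rewrite ?pe ?pf ?pi //.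
by split=> [t a b _ _|a b _ _]; rewrite ?pl ?sub_val_lin ?pb.
Qed.

Lemma stable_ideal (P : set L) : submod P ->
  (forall j w, P w -> P (br (e j) w)) -> (forall j w, P w -> P (br (f j) w)) ->
  (forall h w, P w -> P (br (i h) w)) -> lideal br P.
Proof.
move=> hP he hf hi; split=> // u v; apply: (lgen_stable lie hP); last exact: generated.
by move=> _ w [[[j _ <-]|[j _ <-]]|[h _ <-]]; [exact: he|exact: hf|exact: hi].
Qed.

Lemma f_on_plus j u : eta_p u -> exists h xp, eta_p xp /\ br (f j) u = i h + xp.
Proof.
move=> hu; have := @e_on_minus _ _ _ _ _ _ _ lie _ _ _ (rrel_swap lie rel) j u.
rewrite lgen_opp // => /(_ hu) [xp [h [hxp E]]].
exists h, (- xp); split; first exact: (submodN (proj1 (lsub_lgen br _))).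
by apply: oppr_inj; rewrite -(brNl lie) E opprD opprK addrC.
Qed.

Lemma eta_p_br_i h u : eta_p u -> eta_p (br (i h) u).
Proof. exact: (lgen_weight_stable lie (weight_e rel)). Qed.

Lemma eta_m_br_i h u : eta_m u -> eta_m (br (i h) u).
Proof. exact: (lgen_weight_stable lie (weight_f rel)). Qed.

Lemma eta_p_submod : submod eta_p. Proof. exact: (proj1 (lsub_lgen br _)). Qed.
Lemma eta_m_submod : submod eta_m. Proof. exact: (proj1 (lsub_lgen br _)). Qed.

Lemma triangular u : exists xm h xp, [/\ eta_m xm, eta_p xp & u = xm + i h + xp].
Proof.
pose P := [set u | exists xm h xp, [/\ eta_m xm, eta_p xp & u = xm + i h + xp]].
have m0 := proj1 eta_m_submod; have p0 := proj1 eta_p_submod.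
have i0 := i_lin0 rel.
have iD h h' : i (h + h') = i h + i h' by rewrite (lin_onD (rr_lin rel)).
have Pm x : eta_m x -> P x by exists x, 0, 0; rewrite i0 !addr0.
have Pp x : eta_p x -> P x by exists 0, 0, x; rewrite i0 !add0r.
have Pi h : P (i h) by exists 0, h, 0; rewrite add0r addr0.
have hP : submod P.
  split; first exact: Pm.
  move=> t x y [am [ah [ap [h1 h2 ->]]]] [bm [bh [bp [h3 h4 ->]]]].
  exists (t *: am + bm), (t *: ah + bh), (t *: ap + bp); split.
  - by apply: (proj2 eta_m_submod).
  - by apply: (proj2 eta_p_submod).
  by rewrite (rr_lin rel) // !scalerDr addrACA; congr (_ + _); rewrite addrACA.
(* Nine cases, one for each kind of generator and each summand. An ideal that contains all the
   generators is the whole algebra. *)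
have hI : lideal br P.
  apply: stable_ideal => // [j w|j w|h w] [xm [h' [xp [hm hp ->]]]];
    rewrite !(brDr lie); apply: (submodD hP); try apply: (submodD hP).
  - have [ym [h'' [hym ->]]] := e_on_minus lie rel j hm.
    by apply: (submodD hP); [exact: Pm|exact: Pi].
  - rewrite (il_anti lie) (rr_he rel); apply: Pp.
    apply: (submodN eta_p_submod); apply: (submodZ _ eta_p_submod).
    by apply: sub_lgen; exists j.
  - by apply: Pp; apply: (proj2 (lsub_lgen br _)) => //; apply: sub_lgen; exists j.
  - by apply: Pm; apply: (proj2 (lsub_lgen br _)) => //; apply: sub_lgen; exists j.
  - rewrite (il_anti lie) (rr_hf rel) opprK; apply: Pm.
    apply: (submodZ _ eta_m_submod).
    by apply: sub_lgen; exists j.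
  - have [h'' [yp [hyp ->]]] := f_on_plus j hp.
    by apply: (submodD hP); [exact: Pi|exact: Pp].
  - by apply: Pm; apply: eta_m_br_i.
  - by rewrite (rr_hh rel); apply: Pm.
  - by apply: Pp; apply: eta_p_br_i.
have hL : lsub br P by split=> // x y _; apply: (proj2 hI).
apply: (generated u hL) => _ [[[j _ <-]|[j _ <-]]|[h _ <-]]; last exact: Pi.
  by apply: Pp; apply: sub_lgen; exists j.
by apply: Pm; apply: sub_lgen; exists j.
Qed.

(** The relation is applied to [D] in the word module and read at the empty word. There [eta_+]
    gives 0, [h] multiplies by [- lam h], and [eta_-] gives a series without [D] coordinate. So the
    [D] coordinate yields [lam h = 0] for each linear [lam], and the series determines [xm]. *)
Lemma triangular_direct xm h xp : eta_m xm -> eta_p xp -> xm + i h + xp = 0 ->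
  [/\ xm = 0, h = 0 & xp = 0].
Proof.
move=> hm hp E.
have key (lam : h0 -> R^o) : lin_on setT lam -> lam h = 0 /\ (h = 0 -> xm = 0).
  move=> lam_lin.
  have [rho [rho_lin rhoL rho_br [rho_e rho_f rho_i]]] :=
    word_action beta_lin (loopD L) lam_lin pres.
  have xpE a : rho xp a [::] = 0.
    pose Q := [set z | forall a, rho z a [::] = 0].
    apply: (hp Q) => [|_ [j _ <-] b]; last by rewrite rho_e.
    split; first split.
    + by move=> b; rewrite (lin_on0 (submodT L) rhoL).
    + by move=> t z z' hz hz' b; rewrite rhoL //
        -[LHS]/(t *: rho z b [::] + rho z' b [::]) hz hz' scaler0 addr0.
    move=> z z' hz hz' b; rewrite rho_br.
    by rewrite -[LHS]/(rho z (rho z' b) [::] - rho z' (rho z b) [::]) hz hz' subrr.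
  (* The test algebra is [L] itself with [y_j = f_j], so each element of [eta_-] is matched with
     itself. *)
  have xmE : matches br f rho xm xm.
    apply: (hm [set z | matches br f rho z z]) => [|_ [j _ <-]]; last exact: matches_f.
    split; first split; first exact: matches0.
    + by move=> t z z' hz hz'; apply: matches_add => //; apply: matchesZ.
    + by move=> z z' hz hz'; apply: matches_br.
  have iE : rho (i h) (embed br f (0, 1)) [::] = - lam h *: ((0, 1) : loopD L).
    by rewrite rho_i /word_H /wt big_nil sub0r.
  have : rho (xm + i h + xp) (embed br f (0, 1)) [::] = 0.
    by rewrite E (lin_on0 (submodT L) rhoL).
  rewrite !(lin_onD rhoL) //.
  rewrite -[LHS]/(rho xm (embed br f (0, 1)) [::] + rho (i h) (embed br f (0, 1)) [::]
     + rho xp (embed br f (0, 1)) [::]) xpE addr0 iE => E2.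
  have [m2 _] := matches_eval lie rhoL xmE.
  have lam0 : lam h = 0.
    have /eqP := congr1 (fun x : loopD L => x.2) E2.
    rewrite -[X in X == _]/((rho xm (embed br f (0, 1)) [::]).2 + - lam h * 1) m2.
    by rewrite add0r mulr1 oppr_eq0 => /eqP.
  split=> // _; apply: (matches_eq0 lie rhoL xmE) => m.
  have := congr1 (fun x : loopD L => x.1 m) E2.
  rewrite -[X in X = _ -> _]/((rho xm (embed br f (0, 1)) [::]).1 m + - lam h *: 0).
  by rewrite scaler0 addr0.
have h00 : h = 0 by apply: h0_sep => lam /key [].
have xm0 : xm = 0.
  apply: (proj2 (key (fun=> 0) _)) => //.
  by move=> t x y _ _; rewrite scaler0 addr0.
by split=> //; move: E; rewrite xm0 h00 (i_lin0 rel) !add0r.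
Qed.

End Presented.
End Structure.

(** * Root spaces and graded ideals over the reals *)

Section RootsAndIdeals.
Variables (R : realType) (n : nat) (h0 : lmodType R).
Variables (beta : 'I_n -> h0 -> R^o) (gamma : 'I_n -> h0).
Hypothesis beta_lin : forall j, lin_on setT (beta j).
Hypothesis beta_free : forall d : 'I_n -> R,
  (forall h, \sum_j d j * beta j h = 0) -> forall j, d j = 0.
Hypothesis h0_sep : forall h : h0,
  (forall lam : h0 -> R^o, lin_on setT lam -> lam h = 0) -> h = 0.
Variables (L : lmodType R) (br : L -> L -> L).
Hypothesis lie : is_lie br.
Variables (e f : 'I_n -> L) (i : h0 -> L).
Hypothesis pres : presented beta gamma br e f i.
Let rel := pr_rel pres.

Local Notation eta_p := (lgen br (range e)).
Local Notation eta_m := (lgen br (range f)).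
Local Notation comb c := (fun h => \sum_j (c j)%:R * beta j h).
Local Notation nbeta := (fun j h => - beta j h).
Local Notation word := (seq 'I_n * 'I_n)%type.

Lemma triangular_lists u : exists (lm lp : seq (R * word)) h,
  u = \sum_(p <- lm) p.1 *: rnorm br f p.2 + i h + \sum_(p <- lp) p.1 *: rnorm br e p.2.
Proof.
have [xm [h [xp [hm hp ->]]]] := triangular lie pres u.
have [lm ->] := lgen_rspan lie hm; have [lp ->] := lgen_rspan lie hp.
by exists lm, lp, h.
Qed.

Lemma weight_i h : weight_space br i (fun=> 0) (i h).
Proof. by move=> h'; rewrite (rr_hh rel) scale0r. Qed.

(** The summand [u0] allows two uses: with [I = {0}] and [u0 = - u] a weight vector is compared with
    its own expansion, and with [u0 = 0] the weight components of an element of an ideal are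
    extracted. *)
Lemma components (I : set L) b0 u0 (lm lp : seq (R * word)) h :
  submod I -> (forall h u, I u -> I (br (i h) u)) -> weight_space br i b0 u0 ->
  I (u0 + (\sum_(p <- lm) p.1 *: rnorm br f p.2 + i h
           + \sum_(p <- lp) p.1 *: rnorm br e p.2)) ->
  forall b,
  I ((if b0 == b then u0 else 0)
     + (\sum_(p <- lm | rwt nbeta p.2 == b) p.1 *: rnorm br f p.2
        + (if (fun=> 0) == b then i h else 0)
        + \sum_(p <- lp | rwt beta p.2 == b) p.1 *: rnorm br e p.2)).
Proof.
move=> hI st hu0 hs b.
pose l := (b0, u0) :: [seq (rwt nbeta p.2, p.1 *: rnorm br f p.2) | p <- lm]
  ++ ((fun=> 0), i h) :: [seq (rwt beta p.2, p.1 *: rnorm br e p.2) | p <- lp].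
have hl p : p \in l -> weight_space br i p.1 p.2.
  rewrite in_cons mem_cat in_cons => /orP[/eqP->//|/orP[|/orP[/eqP->|]]].
  - move=> /mapP[q _ ->]; apply: (submodZ _ (weight_space_submod lie _ _)).
    exact: (rnorm_weight lie (weight_f rel)).
  - exact: weight_i.
  - move=> /mapP[q _ ->]; apply: (submodZ _ (weight_space_submod lie _ _)).
    exact: (rnorm_weight lie (weight_e rel)).
have := weights_sum lie hI st hl _ b.
rewrite /l !(big_cons, big_cat) /= !(big_cons, big_map) /=.
rewrite !addrA in hs *; move=> /(_ hs).
by case: ifP => _; case: ifP => _; rewrite ?addr0 ?add0r ?addrA.
Qed.

Lemma zero_submod : submod [set 0 : L].
Proof. by split=> // t _ _ -> ->; rewrite scaler0 addr0. Qed.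

Lemma zero_stable h u : [set 0 : L] u -> [set 0 : L] (br (i h) u).
Proof. by move=> ->; rewrite /= (br0r lie). Qed.

Lemma weight_pos (c : 'I_n -> nat) u : comb c <> (fun=> 0) ->
  weight_space br i (comb c) u ->
  exists lp : seq (R * word),
    u = \sum_(p <- lp | rwt beta p.2 == comb c) p.1 *: rnorm br e p.2.
Proof.
move=> c0 hu; have [lm [lp [h E]]] := triangular_lists u; exists lp.
have hu' : weight_space br i (comb c) (- u).
  exact: (submodN (weight_space_submod lie _ _)).
have := components zero_submod zero_stable hu' (lm := lm) (lp := lp) (h := h).
rewrite -E addNr => /(_ erefl (comb c)).
rewrite eqxx (_ : (_ == comb c) = false); last by apply/eqP => /esym.
rewrite [X in - u + (X + 0 + _)]big_pred0; last first.
  by move=> p; apply/eqP; apply: rwtN_neq_pos.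
by rewrite addr0 add0r => /eqP; rewrite addrC subr_eq0 => /eqP ->.
Qed.

Lemma weight_in_eta_p (c : 'I_n -> nat) u : comb c <> (fun=> 0) ->
  weight_space br i (comb c) u -> eta_p u.
Proof.
move=> c0 /(weight_pos c0) [lp ->]; have hp := eta_p_submod br e.
by apply: (submod_sum _ hp) => p _; apply: (submodZ _ hp); apply: lgen_rnorm.
Qed.

Lemma sum_count_mem (w : seq 'I_n) : (\sum_j count_mem j w = size w)%N.
Proof.
elim: w => [|k w IH]; first by rewrite big1.
rewrite /= big_split /= IH -[RHS]add1n; congr (_ + _)%N.
by rewrite (bigD1 k) //= eqxx big1 ?addn0 // => j /negbTE; rewrite eq_sym => ->.
Qed.

Lemma words_of_weight (c : 'I_n -> nat) : exists s : seq word,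
  uniq s /\ forall p, (p \in s) = (rwt beta p == comb c).
Proof.
pose m := (\sum_j c j)%N.
(* A word of this weight has [m] letters in all, so the first entry of the pair has [m.-1]. For
   [m = 0] there is no such word and the filter leaves nothing. *)
pose s := [seq (tval q.1, q.2) | q <- enum {: (m.-1).-tuple 'I_n * 'I_n}].
exists [seq p <- undup s | rwt beta p == comb c]; split.
  by apply: filter_uniq; apply: undup_uniq.
move=> p; rewrite mem_filter; case: eqP => //= E; rewrite mem_undup.
have hc j : count_mem j (rcons p.1 p.2) = c j.
  apply/eqP; rewrite -(eqr_nat R); apply/eqP; move: j.
  by apply: (comb_inj beta_free); rewrite -rwt1.
have hs : size p.1 == m.-1.
  by rewrite /m -(eq_bigr _ (fun j _ => hc j)) sum_count_mem size_rcons.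
apply/mapP; exists (Tuple hs, p.2); first by rewrite mem_enum.
exact: surjective_pairing.
Qed.

Lemma weight_finite (c : 'I_n -> nat) : comb c <> (fun=> 0) ->
  exists (m : nat) (v : 'I_m -> L), (forall k, weight_space br i (comb c) (v k)) /\
    forall u, weight_space br i (comb c) u ->
    exists a : 'I_m -> R, u = \sum_k a k *: v k.
Proof.
move=> c0; have [s [us hs]] := words_of_weight c.
exists (size s), (fun k => rnorm br e (tnth (in_tuple s) k)); split.
  move=> k; have /eqP <- : rwt beta (tnth (in_tuple s) k) == comb c.
    by rewrite -hs mem_tnth.
  exact: (rnorm_weight lie (weight_e rel)).
move=> u /(weight_pos c0) [lp ->].
exists (fun k => \sum_(p <- lp | p.2 == tnth (in_tuple s) k) p.1).
rewrite -(big_tnth _ _ _ predT (fun q => (\sum_(p <- lp | p.2 == q) p.1) *: rnorm br e q)).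
rewrite (eq_bigr (fun q => \sum_(p <- lp) if p.2 == q then p.1 *: rnorm br e p.2 else 0)).
  rewrite exchange_big big_mkcond; apply: eq_bigr => p _.
  rewrite -hs -big_mkcond -big_filter.
  have -> : seq.filter (eq_op p.2) s = seq.filter (pred1 p.2) s.
    by apply: eq_filter => q; rewrite /= eq_sym.
  case: ifP => ps; first by rewrite filter_pred1_uniq // big_seq1.
  rewrite big_filter big_seq_cond big_pred0 // => q; apply/negP => /andP[qs /eqP qp].
  by rewrite -qp qs in ps.
move=> q _; rewrite scaler_suml big_mkcond; apply: eq_bigr => p _.
by case: eqP => [->|].
Qed.

Section IdealCore.
Variable S : set L.
Hypothesis hS : submod S.

Definition ideal_core : set L := [set u | exists I, [/\ lideal br I, I `<=` S & I u]].

(** The union of the ideals inside [S] is closed under addition, because the sum of two of them is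
    again an ideal inside the subspace [S]. *)
Lemma ideal_core_ideal : lideal br ideal_core.
Proof.
split; last first.
  by move=> u v [I [hI IS Iv]]; exists I; split=> //; apply: (proj2 hI).
split.
  exists [set 0]; split=> //; last by move=> _ ->; case: hS.
  by split; [exact: zero_submod|move=> a _ ->; rewrite /= (br0r lie)].
move=> t u v [I [hI IS Iu]] [J [hJ JS Jv]].
exists [set w | exists a b, [/\ I a, J b & w = a + b]]; split.
- split; first split.
  + by exists 0, 0; rewrite addr0; split=> //; [case: (proj1 hI)|case: (proj1 hJ)].
  + move=> t' _ _ [a [b [Ia Jb ->]]] [a' [b' [Ia' Jb' ->]]].
    exists (t' *: a + a'), (t' *: b + b'); split.
    * exact: (proj2 (proj1 hI)).
    * exact: (proj2 (proj1 hJ)).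
    by rewrite scalerDr addrACA.
  move=> w _ [a [b [Ia Jb ->]]]; exists (br w a), (br w b).
  by rewrite (brDr lie); split=> //; [apply: (proj2 hI)|apply: (proj2 hJ)].
- by move=> _ [a [b [/IS Sa /JS Sb ->]]]; apply: submodD.
by exists (t *: u), v; split=> //; apply: (submodZ _ (proj1 hI)).
Qed.

Lemma ideal_core_sub : ideal_core `<=` S.
Proof. by move=> u [I [_ IS Iu]]; apply: IS. Qed.

End IdealCore.

(** The component of weight 0 is [i h]; it lies in the ideal, hence vanishes. A component of
    positive weight involves only brackets of the [e_j], so their sum [z] lies in the ideal, and [y]
    is the difference. *)
Lemma ideal_graded (I : set L) u : lideal br I -> (forall h, I (i h) -> i h = 0) ->
  I u -> exists y z, [/\ eta_m y, eta_p z, I y, I z & u = y + z].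
Proof.
move=> hI Ih Iu; have [lm [lp [h E]]] := triangular_lists u.
have hw0 : weight_space br i (fun=> 0) 0 by case: (weight_space_submod lie i (fun=> 0)).
have comp := components (proj1 hI) (fun h v => proj2 hI (i h) v) hw0 (lm := lm) (lp :=
  lp) (h := h).
rewrite -E add0r in comp; have {}comp := comp Iu.
have ih0 : i h = 0.
  apply: Ih; have := comp (fun=> 0); rewrite eqxx add0r.
  rewrite big_pred0 => [|p]; last by apply/eqP; apply: rwtN_neq0.
  rewrite big_pred0 => [|p]; last by apply/eqP; apply: rwt_neq0.
  by rewrite add0r addr0.
exists (\sum_(p <- lm) p.1 *: rnorm br f p.2), (\sum_(p <- lp) p.1 *: rnorm br e p.2).
have hp := eta_p_submod br e; have hm := eta_m_submod br f.
have Ip : I (\sum_(p <- lp) p.1 *: rnorm br e p.2).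
  pose l := [seq (rwt beta p.2, p.1 *: rnorm br e p.2) | p <- lp].
  have := sum_by_fst (undup_uniq (map fst l)) (l := l).
  rewrite big_map => ->; last by move=> p pl; rewrite mem_undup map_f.
  rewrite big_seq; apply: (submod_sum _ (proj1 hI)) => b.
  rewrite mem_undup -map_comp => /mapP[q _ bE].
  rewrite big_map; have := comp b; rewrite if_same add0r ih0 if_same addr0.
  rewrite [X in I (X + _) -> _]big_pred0 ?add0r // => p; apply/eqP.
  by rewrite bE -[X in _ <> X]/(rwt beta q.2) [X in _ <> X]rwt1; apply: rwtN_neq_pos.
split=> //.
- by apply: (submod_sum _ hm) => p _; apply: (submodZ _ hm); apply: lgen_rnorm.
- by apply: (submod_sum _ hp) => p _; apply: (submodZ _ hp); apply: lgen_rnorm.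
- rewrite ih0 addr0 in E.
  have -> : \sum_(p <- lm) p.1 *: rnorm br f p.2
          = u - \sum_(p <- lp) p.1 *: rnorm br e p.2 by rewrite E addrK.
  exact: (submodB (proj1 hI)).
by rewrite E ih0 addr0.
Qed.

(** Only the [f_j] could lead out of [eta_+]. But [[f_j, w]] lies in [h + eta_+] and, as an element
    of the ideal, in [eta_- + eta_+]; directness removes its [h] component. *)
Lemma ideal_eta_p (I : set L) : lideal br I -> (forall h, I (i h) -> i h = 0) ->
  lideal br (I `&` eta_p).
Proof.
move=> hI Ih; have hp := lsub_lgen br (range e).
apply: (stable_ideal lie pres).
- split; first by split; [case: (proj1 hI)|case: (proj1 hp)].
  by move=> t a b [Ia pa] [Ib pb]; split; [apply: (proj2 (proj1 hI))|apply: (proj2 (proj1 hp))].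
- move=> j w [Iw pw]; split; first exact: (proj2 hI).
  by apply: (proj2 hp) => //; apply: sub_lgen; exists j.
- move=> j w [Iw pw]; have Ifw : I (br (f j) w) by apply: (proj2 hI).
  split=> //; have [h [xp [hxp E]]] := f_on_plus lie pres j pw.
  have [y [z [my pz Iy Iz E']]] := ideal_graded hI Ih Ifw.
  have [] := triangular_direct beta_lin h0_sep lie pres (xm := - y) (h := h) (xp := xp - z).
  + exact: (submodN (eta_m_submod br f)).
  + exact: (submodB (proj1 hp)).
  + rewrite -addrA [i h + _]addrA -E E' addrK.
    by rewrite addNr.
  by move=> _ h00 _; rewrite E h00 (i_lin0 rel) add0r.
- move=> h w [Iw pw]; split; first exact: (proj2 hI).
  exact: (eta_p_br_i lie pres).
Qed.

End RootsAndIdeals.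

(** * Negative roots, the involution and the largest ideal over the reals *)

Section BothHalves.
Variables (R : realType) (n : nat) (h0 : lmodType R).
Variables (beta : 'I_n -> h0 -> R^o) (gamma : 'I_n -> h0).
Hypothesis beta_lin : forall j, lin_on setT (beta j).
Hypothesis beta_free : forall d : 'I_n -> R,
  (forall h, \sum_j d j * beta j h = 0) -> forall j, d j = 0.
Hypothesis h0_sep : forall h : h0,
  (forall lam : h0 -> R^o, lin_on setT lam -> lam h = 0) -> h = 0.
Variables (L : lmodType R) (br : L -> L -> L).
Hypothesis lie : is_lie br.
Variables (e f : 'I_n -> L) (i : h0 -> L).
Hypothesis pres : presented beta gamma br e f i.
Let rel := pr_rel pres.
Let pres' := presented_swap lie pres.

Local Notation eta_p := (lgen br (range e)).
Local Notation eta_m := (lgen br (range f)).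
Local Notation comb c := (fun h => \sum_j (c j)%:R * beta j h).

Lemma weight_space_opp (b : h0 -> R) :
  weight_space br (fun h => - i h) b = weight_space br i (fun h => - b h).
Proof.
rewrite predeqE => u; split=> H h; have := H h; rewrite ?(brNl lie) ?scaleNr.
  by move/(congr1 -%R); rewrite opprK.
by move=> ->; rewrite opprK.
Qed.

Lemma weight_in_eta_m (c : 'I_n -> nat) u : comb c <> (fun=> 0) ->
  weight_space br i (fun h => - comb c h) u -> eta_m u.
Proof.
move=> c0; rewrite -weight_space_opp -(lgen_opp br f).
exact: (weight_in_eta_p beta_free lie pres').
Qed.

Lemma weight_finiteN (c : 'I_n -> nat) : comb c <> (fun=> 0) ->
  exists (m : nat) (v : 'I_m -> L),
    (forall k, weight_space br i (fun h => - comb c h) (v k)) /\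
    forall u, weight_space br i (fun h => - comb c h) u ->
    exists a : 'I_m -> R, u = \sum_k a k *: v k.
Proof.
by move=> c0; rewrite -weight_space_opp; apply: (weight_finite beta_free lie pres').
Qed.

Lemma lgen_e_free (K : lmodType R) (brK : K -> K -> K) (lieK : is_lie brK)
    (y : 'I_n -> K) : exists phi : L -> K,
  lhom_on br brK eta_p phi /\ forall j, phi (e j) = y j.
Proof.
have z_lin : lin_on setT ((fun=> 0) : h0 -> R^o).
  by move=> t u v _ _; rewrite scaler0 addr0.
have [phi [hphi E]] := lgen_f_free beta_lin lie pres' lieK (fun j => - y j) z_lin.
exists phi; move: hphi; rewrite lgen_opp // => hphi; split=> // j.
apply: oppr_inj; rewrite -E (lin_onN (eta_p_submod br e) (proj1 hphi)) //.
by apply: sub_lgen; exists j.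
Qed.

Lemma lgen_f_free0 (K : lmodType R) (brK : K -> K -> K) (lieK : is_lie brK)
    (y : 'I_n -> K) : exists phi : L -> K,
  lhom_on br brK eta_m phi /\ forall j, phi (f j) = y j.
Proof.
apply: (lgen_f_free beta_lin lie pres lieK y (lam := fun=> 0)).
by move=> t u v _ _; rewrite scaler0 addr0.
Qed.

(** The square of the induced endomorphism fixes the generators, so it is the identity by
    uniqueness. *)
Lemma chevalley_involution : exists omega : L -> L,
  [/\ lhom_on br br setT omega, forall u, omega (omega u) = u,
      forall j, omega (e j) = - f j, forall j, omega (f j) = - e j
    & forall h, omega (i h) = - i h].
Proof.
have [omega [[ol ob] oe of_ oi]] := pr_ex pres lie (rrel_swap lie rel).
have oN u : omega (- u) = - omega u by rewrite (lin_onN (submodT L) ol).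
exists omega; split=> // u.
apply: (pr_uniq pres lie rel (phi := fun v => omega (omega v)) (psi := id)) => //.
- by split=> [t a b _ _|a b _ _]; rewrite ?ol ?ob.
- by move=> j; rewrite oe oN of_ opprK.
- by move=> j; rewrite of_ oN oe opprK.
- by move=> h; rewrite oi oN oi opprK.
- by move=> j; rewrite oe oN of_ opprK.
- by move=> j; rewrite of_ oN oe opprK.
- by move=> h; rewrite oi oN oi opprK.
Qed.

Lemma i_inj h : i h = 0 -> h = 0.
Proof.
move=> h_0; have [] := triangular_direct beta_lin h0_sep lie pres (xm := 0) (h := h) (xp := 0).
- by case: (eta_m_submod br f).
- by case: (eta_p_submod br e).
- by rewrite h_0 !addr0.
by [].
Qed.

Lemma ideal_eta_m (I : set L) : lideal br I -> (forall h, I (i h) -> i h = 0) ->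
  lideal br (I `&` eta_m).
Proof.
move=> hI Ih; rewrite -(lgen_opp br f).
apply: (ideal_eta_p beta_lin beta_free h0_sep lie pres') => // h /(submodN (proj1 hI)).
by rewrite opprK => /Ih ->; rewrite oppr0.
Qed.

Lemma maximal_ideal : exists tau : set L,
  [/\ lideal br tau, forall h, tau (i h) -> i h = 0,
      forall I, lideal br I -> (forall h, I (i h) -> i h = 0) -> I `<=` tau
    & forall u, tau u ->
        exists y z, [/\ (tau `&` eta_m) y, (tau `&` eta_p) z & u = y + z]].
Proof.
pose tm := ideal_core br eta_m; pose tp := ideal_core br eta_p.
have im : lideal br tm := ideal_core_ideal lie (eta_m_submod br f).
have ip : lideal br tp := ideal_core_ideal lie (eta_p_submod br e).
have mE : tm `<=` eta_m by exact: ideal_core_sub.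
have pE : tp `<=` eta_p by exact: ideal_core_sub.
pose tau := [set u | exists y z, [/\ tm y, tp z & u = y + z]].
have mt : tm `<=` tau.
  by move=> u hu; exists u, 0; rewrite addr0; split=> //; case: (proj1 ip).
have pt : tp `<=` tau.
  by move=> u hu; exists 0, u; rewrite add0r; split=> //; case: (proj1 im).
exists tau; split.
- split; first split.
  + by apply: mt; case: (proj1 im).
  + move=> t _ _ [a [b [ha hb ->]]] [a' [b' [ha' hb' ->]]].
    exists (t *: a + a'), (t *: b + b'); rewrite scalerDr addrACA; split=> //.
      exact: (proj2 (proj1 im)).
    exact: (proj2 (proj1 ip)).
  move=> w _ [a [b [ha hb ->]]]; exists (br w a), (br w b).
  by rewrite (brDr lie); split=> //; [apply: (proj2 im)|apply: (proj2 ip)].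
- move=> h [y [z [/mE hy /pE hz E]]].
  have [] := triangular_direct beta_lin h0_sep lie pres (xm := - y) (h := h) (xp := - z).
  + exact: (submodN (eta_m_submod br f)).
  + exact: (submodN (eta_p_submod br e)).
  + by rewrite E [y + z]addrC addrA addrAC addNr add0r subrr.
  by move=> _ -> _; rewrite (i_lin0 rel).
- move=> I hI Ih u Iu.
  have [y [z [hy hz Iy Iz ->]]] := ideal_graded beta_free lie pres hI Ih Iu.
  exists y, z; split=> //.
    exists (I `&` eta_m); split=> //; first exact: ideal_eta_m.
  exists (I `&` eta_p); split=> //.
  exact: (ideal_eta_p beta_lin beta_free h0_sep lie pres).
move=> u [y [z [hy hz ->]]]; exists y, z; split=> //.
  by split; [exact: mt|exact: mE].
by split; [exact: pt|exact: pE].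
Qed.

End BothHalves.

(** * The real form of a realization *)

Section RealForm.
Variables (R : realType) (r : nat) (hr : r = 2%N \/ r = 3%N).
Variables (n : nat) (A : 'M[CD r R]_n) (h0 : vectType R).
Variables (beta : 'I_n -> AV r h0 -> CD r R) (gamma : 'I_n -> AV r h0).
Hypotheses (hreal : realization A beta gamma) (hgamma : forall j, zero_part (gamma j)).

Definition beta0 (j : 'I_n) (v : h0) : R^o := beta j (real0 r v) (oz r).
Definition gamma0 (j : 'I_n) : h0 := gamma j (oz r).

Lemma beta_real0 j v : beta j (real0 r v) = real0 r (beta0 j v).
Proof. exact/zero_part_real0/(rz_real hreal). Qed.

Lemma gammaE j : gamma j = real0 r (gamma0 j).
Proof. exact/zero_part_real0. Qed.

Lemma beta0_lin j : lin_on setT (beta0 j).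
Proof.
move=> t u v _ _; rewrite /beta0 real0D real0Z (proj1 (rz_dual hreal j)).
by rewrite !ffunE.
Qed.

Lemma beta00 j : beta0 j 0 = 0.
Proof. exact: (lin_on0 (submodT h0) (@beta0_lin j)). Qed.

Lemma avmap_pure (V W : lmodType R) (g : V -> W) k v : g 0 = 0 ->
  avmap (r := r) g (pure k v) = pure k (g v).
Proof. by move=> g0; apply/ffunP => j; rewrite !ffunE; case: ifP. Qed.

(** Left linearity makes the value at [i_k v] equal to [i_k] times the value at [v], which is
    real. *)
Lemma betaE j : beta j = avmap (beta0 j).
Proof.
have [bl bz] := rz_dual hreal j.
have bD x y : beta j (x + y) = beta j x + beta j y.
  by have := bl 1 x y; rewrite !scale1r.
have b_0 : beta j 0 = 0 by apply: (addIr (beta j 0)); rewrite -bD !add0r.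
have bS (F : 'I_(2 ^ r) -> AV r h0) : beta j (\sum_k F k) = \sum_k beta j (F k).
  exact: (big_morph (beta j) bD b_0).
apply/funext => y; rewrite [in LHS](AV_sum_pure y) bS [RHS](AV_sum_pure (avmap _ y)).
apply: eq_bigr => k _; rewrite -(lact_genE hr) bz beta_real0 /cdmul lact_genE //.
by rewrite ffunE.
Qed.

Lemma cdmul_gen_real0 k (z : R^o) : cdmul (cdgen R k) (real0 r z) = pure k z.
Proof. exact: lact_genE. Qed.

Lemma lin_ext_real (g : h0 -> R^o) : g 0 = 0 ->
  lin_ext (fun v => real0 r (g v)) = avmap g.
Proof.
move=> g0; apply/funext => x; rewrite [RHS](AV_sum_pure (avmap g x)) /lin_ext.
by apply: eq_bigr => k _; rewrite cdmul_gen_real0 ffunE.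
Qed.

(** Since [beta j] is real on [_0h], only [k = 0] contributes, and there the sign [chi s 0] is
    trivial. *)
Lemma pairing_revE j y : pairing_rev (beta j) y = avmap (beta0 j) y.
Proof.
rewrite /pairing_rev (bigD1 (oz r)) //= [X in _ + X]big1 => [|k k0].
  rewrite addr0 [RHS](AV_sum_pure (avmap _ y)); apply: eq_bigr => s _.
  rewrite /chi andbF expr0 scale1r /pairing ffunE.
  have -> : (fun v => pure (oz r) (beta j (real0 r v) (oz r)))
          = (fun v => real0 r (beta0 j v)) by apply/funext => v; rewrite real0E.
  by rewrite lin_ext_real ?beta00 // avmap_pure ?beta00.
apply: big1 => s _; rewrite /pairing.
have -> : (fun v => pure k (beta j (real0 r v) k)) = (fun=> 0) :> (h0 -> CD r R).
  apply/funext => v; rewrite beta_real0 real0E ffunE (negbTE k0).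
  by apply/ffunP => l; rewrite !ffunE if_same.
rewrite /lin_ext big1 ?scaler0 // => l _.
by apply/ffunP => m; rewrite /cdmul lact_gen // !ffunE scaler0.
Qed.

(** A real relation is a combination with left coefficients [d j] and right coefficients 1. Vector
    independence speaks of nonzero coefficients, so it is applied to the support [K] of [d]. *)
Lemma beta0_free (d : 'I_n -> R) :
  (forall h, \sum_j d j * beta0 j h = 0) -> forall j, d j = 0.
Proof.
move=> hd; apply: contrapT => /existsNP [j0 /eqP dj0].
pose K := [set j | d j != 0]%SET.
have K0 : K != finset.set0 by apply/set0Pn; exists j0; rewrite inE.
have gen0 t : t *: cdgen R (oz r) = real0 r (t : R^o).
  rewrite real0E; apply/ffunP => j; rewrite !ffunE.
  by case: eqP => _; [rewrite [_ *: _]mulr1|rewrite scaler0].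
have hK j : j \in K -> d j *: cdgen R (oz r) != 0 /\ cdgen R (oz r) != 0.
  rewrite inE => dj; split.
    apply: contra dj => /eqP /(congr1 (fun x : CD r R => x (oz r))).
    by rewrite gen0 real0_oz ffunE => ->.
  apply/eqP => /(congr1 (fun x : CD r R => x (oz r))).
  by rewrite !ffunE eqxx => /eqP; rewrite oner_eq0.
have E j : dual_ract (dual_lact (d j *: cdgen R (oz r)) (beta j)) (cdgen R (oz r))
         = avmap (fun v => d j * beta0 j v : R^o).
  have -> : dual_lact (d j *: cdgen R (oz r)) (beta j)
          = avmap (fun v => d j * beta0 j v : R^o).
    rewrite /dual_lact -lin_ext_real ?beta00 ?mulr0 //; congr lin_ext.
    apply/funext => v; rewrite beta_real0 /cdmul lact_scale //.
    by rewrite -real0Z.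
  rewrite /dual_ract -[RHS]lin_ext_real ?beta00 ?mulr0 //; congr lin_ext.
  apply/funext => v; rewrite avmap_real0 ?beta00 ?mulr0 //.
  rewrite -[cdgen R _]scale1r gen0 /cdmul lact_real0 //.
  by apply/ffunP => l; rewrite ffunE [_ *: 1]mulr1.
have /eqP := rz_beta_indep hreal K0 (finset.subsetT K) hK (fun=> true); apply.
apply/funext => x; apply/ffunP => k.
transitivity (\sum_(j in K) d j * beta0 j (x k)).
  rewrite -[RHS]/(\sum_(j in K) (fun j => d j * beta0 j (x k)) j).
  elim/big_rec2: _ => [|j y1 y2 _ IH]; first by rewrite ffunE.
  by rewrite E -IH !ffunE.
transitivity (0 : R); last by rewrite -[RHS]/((0 : CD r R) k) ffunE.
rewrite -[RHS](hd (x k)) [in RHS](bigID (mem K)) /= [X in _ = _ + X]big1 ?addr0 //.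
by move=> j; rewrite inE negbK => /eqP ->; rewrite mul0r.
Qed.

Lemma h0_separated (h : h0) :
  (forall lam : h0 -> R^o, lin_on setT lam -> lam h = 0) -> h = 0.
Proof.
move=> hl; rewrite (coord_vbasis (memvf h)) big1 // => k _.
rewrite (hl (coord (vbasis fullv) k)) ?scale0r // => t u v _ _.
by rewrite linearP.
Qed.

End RealForm.

(** * The real part of eta has the corresponding real presentation *)

Section EtaRealForm.
Variables (R : realType) (r : nat) (hr : r = 2%N \/ r = 3%N).
Variables (n : nat) (A : 'M[CD r R]_n) (h0 : vectType R).
Variables (beta : 'I_n -> AV r h0 -> CD r R) (gamma : 'I_n -> AV r h0).
Hypotheses (hreal : realization A beta gamma) (hgamma : forall j, zero_part (gamma j)).
Variables (eta : lieA R r) (e f : 'I_n -> AV r eta) (iota : AV r h0 -> AV r eta).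
Hypothesis heta : is_eta beta gamma e f iota.

Definition e0 j : eta := e j (oz r).
Definition f0 j : eta := f j (oz r).
Definition i0 (v : h0) : eta := iota (real0 r v) (oz r).

Let hrel := proj1 heta.
Let sc := er_scal hrel.

Lemma AVsubT (V : lmodType R) : AVsub (@setT (AV r V)).
Proof. by []. Qed.

Lemma eE j : e j = real0 r (e0 j). Proof. exact/zero_part_real0/(er_e0 hrel). Qed.
Lemma fE j : f j = real0 r (f0 j). Proof. exact/zero_part_real0/(er_f0 hrel). Qed.

Lemma iotaE : iota = avmap i0.
Proof. by apply/funext => h; rewrite (AVhomE hr (AVsubT h0) (er_h hrel)). Qed.

Lemma i0_lin : lin_on setT i0.
Proof.
move=> t u v _ _.
by have := AVhom_lin_on hr (AVsubT h0) (er_h hrel); apply.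
Qed.

Lemma i00 : i0 0 = 0. Proof. exact: (lin_on0 (submodT h0) i0_lin). Qed.

Lemma iota_real0 v : iota (real0 r v) = real0 r (i0 v).
Proof. by rewrite iotaE avmap_real0 // i00. Qed.

Lemma avbr_real0r (V : lmodType R) (br : V -> V -> V) (lie : is_lie br) x v :
  avbr br x (real0 r v) = [ffun l => br (x l) v].
Proof.
apply/ffunP => l; rewrite !ffunE (bigD1 l) //= big1 => [|j jl].
  by rewrite oidxkk // real0_oz addr0 cd_sgnk0 // scale1r.
rewrite real0E ffunE; case: eqP => [E|]; last by rewrite br0r // scaler0.
by case/eqP: jl; rewrite -[j](oidxk0 hr) -E oidxKl.
Qed.

Lemma real_rel : rrel (beta0 beta) (gamma0 gamma) (@rbr R r eta) e0 f0 i0.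
Proof.
split; first exact: i0_lin.
- move=> j k; apply: (@real0_inj _ r); rewrite -lbr_real0 -eE -fE (er_ef hrel).
  by case: eqP => [->|_]; rewrite ?real00 // {1}(gammaE hgamma) iota_real0.
- move=> h h'; apply: (@real0_inj _ r).
  by rewrite -lbr_real0 -!iota_real0 (er_hh hrel) real00.
- move=> h j; apply: (@real0_inj _ r).
  rewrite -lbr_real0 -iota_real0 -eE (er_he hrel) (pairing_revE hr hreal).
  rewrite avmap_real0 ?(beta00 hreal) // eE lact_real0 //.
  by apply/ffunP => l; rewrite !ffunE; case: ifP => _; rewrite ?scale0r.
- move=> h j; apply: (@real0_inj _ r).
  rewrite -lbr_real0 -iota_real0 -fE (er_hf hrel) (pairing_revE hr hreal).
  rewrite avmap_real0 ?(beta00 hreal) // fE lact_real0 // real0N; congr (- _).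
  by apply/ffunP => l; rewrite !ffunE; case: ifP => _; rewrite ?scale0r.
Qed.

Lemma avset_setT (V : lmodType R) : avset (r := r) (@setT V) = setT.
Proof. by rewrite predeqE. Qed.

Lemma eta_rel_mkLie (K : lmodType R) (brK : K -> K -> K) (lieK : is_lie brK) e' f' i' :
  rrel (beta0 beta) (gamma0 gamma) brK e' f' i' ->
  eta_rel beta gamma (g := mkLie hr lieK) (fun j => real0 r (e' j))
    (fun j => real0 r (f' j)) (avmap i').
Proof.
move=> rel; have iD := rr_lin rel; have i_0 := lin_on0 (submodT h0) iD.
split.
- exact: scalar_compat_mkLie.
- by move=> j; exists (e' j).
- by move=> j; exists (f' j).
- by rewrite -(avset_setT h0); apply: (AVhom_avmap hr).
- move=> j k; rewrite /= avbr_real0 // (rr_ef rel).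
  by case: eqP => [->|_]; rewrite ?real00 // {1}(gammaE hgamma) avmap_real0.
- move=> h h'; apply/ffunP => l; rewrite ffunE big1 ?ffunE // => j _.
  by rewrite !ffunE (rr_hh rel) scaler0.
- move=> h j; rewrite /= avbr_real0r // (pairing_revE hr hreal) lact_real0 //.
  by apply/ffunP => l; rewrite !ffunE (rr_he rel).
- move=> h j; rewrite /= avbr_real0r // (pairing_revE hr hreal) lact_real0 //.
  by apply/ffunP => l; rewrite !ffunE (rr_hf rel).
Qed.

Lemma rbr_mkLie (K : lmodType R) (brK : K -> K -> K) (lieK : is_lie brK) :
  @rbr R r (mkLie hr lieK) = brK.
Proof.
by apply/funext => u; apply/funext => v; rewrite /rbr /= avbr_real0 // real0_oz.
Qed.

Lemma lie_hom_avmapT (k : lieA R r) (phi : eta -> k) : scalar_compat k ->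
  lhom_on (@rbr R r eta) (@rbr R r k) setT phi -> lie_hom (avmap phi).
Proof.
move=> sk hp; rewrite /lie_hom -(avset_setT eta).
by apply: (lie_hom_avmap hr sc sk) => //; split.
Qed.

(** A solution in a real Lie algebra [K] becomes one over A_r after tensoring. Existence takes the
    real part of the resulting map; for uniqueness, both real maps extend componentwise to
    homomorphisms that agree with it. *)
Lemma real_presented :
  presented (beta0 beta) (gamma0 gamma) (@rbr R r eta) e0 f0 i0.
Proof.
split; first exact: real_rel.
- move=> K brK lieK e' f' i' rel.
  have [phi [[hphi pe pf pi] _]] := proj2 heta _ _ _ _ (eta_rel_mkLie lieK rel).
  exists (fun u => phi (real0 r u) (oz r)); split.
  + rewrite -[X in lhom_on _ X](rbr_mkLie lieK).
    have := lie_hom_real hr (AVsubT eta) hphi.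
    by rewrite (_ : (fun _ => _) = setT).
  + by move=> j; rewrite -eE pe real0_oz.
  + by move=> j; rewrite -fE pf real0_oz.
  + by move=> h; rewrite -iota_real0 pi ffunE real0_oz.
move=> K brK lieK e' f' i' rel phi psi hphi hpsi he hf hi pe pf pi u.
have [chi0 [_ uniq_chi]] := proj2 heta _ _ _ _ (eta_rel_mkLie lieK rel).
have key (xi0 : eta -> K) : lhom_on (@rbr R r eta) brK setT xi0 ->
    (forall j, xi0 (e0 j) = e' j) -> (forall j, xi0 (f0 j) = f' j) ->
    (forall h, xi0 (i0 h) = i' h) -> chi0 = avmap (r := r) xi0.
  move=> hxi xe xf xi_; have x0 : xi0 0 = 0 := lin_on0 (submodT eta) (proj1 hxi).
  apply: uniq_chi; split.
  - apply: (@lie_hom_avmapT (mkLie hr lieK)); first exact: scalar_compat_mkLie.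
    by rewrite rbr_mkLie.
  - by move=> j; rewrite eE avmap_real0 // xe.
  - by move=> j; rewrite fE avmap_real0 // xf.
  - by move=> h; apply/ffunP => l; rewrite iotaE !ffunE xi_.
have E1 := key phi hphi pe pf pi.
have E2 : chi0 = avmap psi.
  by apply: key => // x; rewrite -?he -?hf -?hi.
have := congr1 (fun g : AV r eta -> AV r K => g (real0 r u) (oz r)) (etrans (esym E1) E2).
by rewrite !ffunE.
Qed.

End EtaRealForm.

(** * Triangular decomposition, freeness, involution and root spaces over A_r *)

Section EtaStructure.
Variables (R : realType) (r : nat) (hr : r = 2%N \/ r = 3%N).
Variables (n : nat) (A : 'M[CD r R]_n) (h0 : vectType R).
Variables (beta : 'I_n -> AV r h0 -> CD r R) (gamma : 'I_n -> AV r h0).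
Hypotheses (hreal : realization A beta gamma) (hgamma : forall j, zero_part (gamma j)).
Variables (eta : lieA R r) (e f : 'I_n -> AV r eta) (iota : AV r h0 -> AV r eta).
Hypothesis heta : is_eta beta gamma e f iota.

Local Notation eta_p := (lie_gen (range e)).
Local Notation eta_m := (lie_gen (range f)).
Local Notation Q1 := (Qplus beta `\ 0).
Local Notation B0 := (beta0 beta).
Local Notation br := (@rbr R r eta).
Local Notation e' := (e0 e).
Local Notation f' := (f0 f).
Local Notation i' := (i0 iota).
Local Notation eta_p0 := (lgen br (range e')).
Local Notation eta_m0 := (lgen br (range f')).
Local Notation comb c := (fun h => \sum_j (c j)%:R * B0 j h).

Let sc := er_scal (proj1 heta).
Let lie : is_lie br := rbr_lie eta.
Let pres := real_presented hr hreal hgamma heta.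
Let bl := beta0_lin hreal.
Let bf := beta0_free hr hreal.
Let hs := @h0_separated R h0.

Lemma eta_pE : eta_p = avset eta_p0.
Proof.
rewrite -(lie_genE hr sc); congr lie_gen; rewrite predeqE => x; split.
  by move=> [j _ <-]; exists (e' j); [exists j|rewrite -(eE heta)].
by move=> [_ [j _ <-] <-]; exists j => //; rewrite -(eE heta).
Qed.

Lemma eta_mE : eta_m = avset eta_m0.
Proof.
rewrite -(lie_genE hr sc); congr lie_gen; rewrite predeqE => x; split.
  by move=> [j _ <-]; exists (f' j); [exists j|rewrite -(fE heta)].
by move=> [_ [j _ <-] <-]; exists j => //; rewrite -(fE heta).
Qed.

Lemma iota_comp h k : iota h k = i' (h k).
Proof. by rewrite {1}(iotaE hr heta) ffunE. Qed.

Lemma eta_triangular (x : AV r eta) : exists xm h xp,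
  [/\ eta_m xm, eta_p xp & x = xm + iota h + xp].
Proof.
have /choice [t ht] : forall k, exists t : eta * h0 * eta,
    [/\ eta_m0 t.1.1, eta_p0 t.2 & x k = t.1.1 + i' t.1.2 + t.2].
  move=> k; have [xm [h [xp H]]] := triangular lie pres (x k).
  by exists (xm, h, xp).
exists [ffun k => (t k).1.1], [ffun k => (t k).1.2], [ffun k => (t k).2]; split.
- by rewrite eta_mE => k; rewrite ffunE; case: (ht k).
- by rewrite eta_pE => k; rewrite ffunE; case: (ht k).
by apply/ffunP => k; rewrite !ffunE iota_comp ffunE; case: (ht k).
Qed.

Lemma eta_direct xm h xp : eta_m xm -> eta_p xp -> xm + iota h + xp = 0 ->
  [/\ xm = 0, h = 0 & xp = 0].
Proof.
rewrite eta_mE eta_pE => hm hp E.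
have H k : [/\ xm k = 0, h k = 0 & xp k = 0].
  apply: (triangular_direct bl hs lie pres) => //.
  by have := congr1 (fun x : AV r eta => x k) E; rewrite !ffunE iota_comp.
by split; apply/ffunP => k; rewrite ffunE; case: (H k).
Qed.

(** The set where both maps agree is a subalgebra only inside [lie_gen S], the domain on which they
    are homomorphisms; hence the intersection [P]. *)
Lemma lie_hom_on_uniq (g k : lieA R r) (S : set (AV r g)) (phi psi : AV r g -> AV r k) :
  lie_hom_on (lie_gen S) phi -> lie_hom_on (lie_gen S) psi ->
  (forall x, S x -> phi x = psi x) -> forall x, lie_gen S x -> phi x = psi x.
Proof.
move=> [[pD pZ pl pr] pb] [[qD qZ ql qr] qb] E.
have genS x : S x -> lie_gen S x by move=> Sx P _; apply.
have hS : lie_sub (lie_gen S).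
  split; first split.
  - by move=> P [[]].
  - move=> x y hx hy P hP SP; have [_ + _ _] := proj1 hP.
    by apply; [exact: hx|exact: hy].
  - by move=> a x hx P hP SP; have [_ _ + _] := proj1 hP; apply; exact: hx.
  - by move=> a x hx P hP SP; have [_ _ _ +] := proj1 hP; apply; exact: hx.
  by move=> x y hx hy P hP SP; apply: (proj2 hP); [exact: hx|exact: hy].
have [[S0 Sa Sl Sr] Sb] := hS.
pose P := [set x | lie_gen S x /\ phi x = psi x].
have z0 (c : AV r g -> AV r k) : (forall x y, lie_gen S x -> lie_gen S y ->
  c (x + y) = c x + c y) -> c 0 = 0.
  by move=> cD; apply: (addIr (c 0)); rewrite -cD // !add0r.
suff hP : lie_sub P.
  by move=> x hx; have [] := hx P hP (fun y Sy => conj (genS y Sy) (E y Sy)).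
split; first split.
- by split=> //; rewrite !z0.
- by move=> x y [hx ex] [hy ey]; split; [exact: Sa|rewrite pD // qD // ex ey].
- by move=> a x [hx ex]; split; [exact: Sl|rewrite pl // ql // ex].
- by move=> a x [hx ex]; split; [exact: Sr|rewrite pr // qr // ex].
by move=> x y [hx ex] [hy ey]; split; [exact: Sb|rewrite pb // qb // ex ey].
Qed.

Lemma eta_p_free : freely_generated eta_p e.
Proof.
split=> // k sk y hy.
have [phi [hphi E]] := lgen_e_free bl lie pres (rbr_lie k) (fun j => y j (oz r)).
have phi0 : phi 0 = 0 := lin_on0 (eta_p_submod br e') (proj1 hphi).
have hom : lie_hom_on eta_p (avmap phi).
  by rewrite eta_pE; apply: (lie_hom_avmap hr sc sk) => //; apply: lsub_lgen.
have val j : avmap phi (e j) = y j.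
  by rewrite (eE heta) avmap_real0 // E -zero_part_real0.
exists (avmap phi); split=> // psi hpsi psiE z hz.
apply: (lie_hom_on_uniq hpsi hom) hz => _ [j _ <-].
by rewrite psiE val.
Qed.

Lemma eta_m_free : freely_generated eta_m f.
Proof.
split=> // k sk y hy.
have [phi [hphi E]] := lgen_f_free0 bl lie pres (rbr_lie k) (fun j => y j (oz r)).
have phi0 : phi 0 = 0 := lin_on0 (eta_m_submod br f') (proj1 hphi).
have hom : lie_hom_on eta_m (avmap phi).
  by rewrite eta_mE; apply: (lie_hom_avmap hr sc sk) => //; apply: lsub_lgen.
have val j : avmap phi (f j) = y j.
  by rewrite (fE heta) avmap_real0 // E -zero_part_real0.
exists (avmap phi); split=> // psi hpsi psiE z hz.
apply: (lie_hom_on_uniq hpsi hom) hz => _ [j _ <-].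
by rewrite psiE val.
Qed.

Lemma eta_involution : exists! omega : AV r eta -> AV r eta,
  [/\ lie_hom omega, (forall x, omega (omega x) = x),
      (forall j, omega (e j) = - f j), (forall j, omega (f j) = - e j)
    & (forall h, omega (iota h) = - iota h)].
Proof.
have [om [hom omK ome omf omi]] := chevalley_involution lie pres.
have om0 : om 0 = 0 := lin_on0 (submodT eta) (proj1 hom).
exists (avmap om); split; first split.
- exact: (lie_hom_avmapT hr heta sc).
- by move=> x; apply/ffunP => k; rewrite !ffunE omK.
- by move=> j; rewrite (eE heta) avmap_real0 // ome real0N -(fE heta).
- by move=> j; rewrite (fE heta) avmap_real0 // omf real0N -(eE heta).
- by move=> h; apply/ffunP => k; rewrite !ffunE iota_comp omi.
move=> psi [hpsi _ pe pf pi]; apply/funext => x.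
have hom' : lhom_on br br setT (fun u => psi (real0 r u) (oz r)).
  have := lie_hom_real hr (@AVsubT _ r eta) hpsi.
  by rewrite (_ : (fun _ => _) = setT).
rewrite (AVhomE hr (@AVsubT _ r eta) (proj1 hpsi)) //.
apply/ffunP => k; rewrite !ffunE.
apply: (pr_uniq pres lie (rrel_swap lie (pr_rel pres)) (phi := om)
  (psi := fun u => psi (real0 r u) (oz r))) => //.
- by move=> j; rewrite -(eE heta) pe ome ffunE (fE heta) real0_oz.
- by move=> j; rewrite -(fE heta) pf omf ffunE (eE heta) real0_oz.
- by move=> h; rewrite -(iota_real0 hr heta) pi omi ffunE iota_comp real0_oz.
Qed.

Lemma QplusE (b : AV r h0 -> CD r R) (c : 'I_n -> nat) :
  b = \sum_j beta j *+ c j -> b = avmap (comb c : h0 -> R^o).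
Proof.
move=> ->; apply/funext => x; apply/ffunP => k; rewrite ffunE.
elim/big_rec2: _ => [|j y1 y2 _ <-]; first by rewrite -[LHS]/((0 : CD r R) k) ffunE.
rewrite -[LHS]/(((beta j *+ c j) x + y2 x) k) ffunE; congr (_ + _).
rewrite (betaE hr hreal); elim: (c j) => [|m IH].
  by rewrite mul0r -[LHS]/((0 : CD r R) k) ffunE.
rewrite mulrS -[LHS]/((avmap (B0 j) x + (avmap (B0 j) *+ m) x) k) ffunE IH ffunE.
by rewrite -natr1 mulrDl mul1r addrC.
Qed.

Lemma Q1P b : Q1 b -> exists c : 'I_n -> nat,
  b = avmap (comb c : h0 -> R^o) /\ comb c <> (fun=> 0).
Proof.
move=> [[c bE] b0]; exists c; have E := QplusE bE; split=> // c0; apply: b0.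
rewrite E c0; apply/funext => x; apply/ffunP => k.
by rewrite [LHS]ffunE -[RHS]/((0 : CD r R) k) ffunE.
Qed.

Lemma avmapN (g : h0 -> R^o) : - (avmap g : AV r h0 -> CD r R) = avmap (fun h => - g h).
Proof.
apply/funext => x; apply/ffunP => k.
by rewrite -[LHS]/((- avmap g x) k) !ffunE.
Qed.

(** For real [h] the factor [g h] is a real scalar, which gives the condition on each component.
    Conversely, the bracket and the action of A_r involve the same indices and signs, so they agree
    term by term. *)
Lemma root_spaceE (g : h0 -> R^o) : g 0 = 0 ->
  root_space iota (avmap g) = avset (weight_space br i' g).
Proof.
move=> g0; rewrite predeqE => x; split=> [H k h|H h].
  have := congr1 (fun z : AV r eta => z k) (H (real0 r h)).
  rewrite (iota_real0 hr heta) lbrE // avmap_real0 //.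
  have -> : lact (real0 r (g h)) x = g h *: x.
    rewrite -[RHS](lact_scale hr); congr lact; apply/ffunP => j.
    rewrite real0E !ffunE.
    by case: eqP => _; [rewrite [_ *: _]mulr1|rewrite scaler0].
  rewrite !ffunE (bigD1 (oz r)) //= big1 => [|j j0].
    by rewrite real0_oz oidx0k // cd_sgn0k // scale1r addr0.
  by rewrite real0E ffunE (negbTE j0) (br0l lie) scaler0.
rewrite (lbrE hr sc); apply/ffunP => l; rewrite [LHS]ffunE [RHS]lactE //.
by apply: eq_bigr => j _; rewrite iota_comp H ffunE.
Qed.

Lemma comb0 (c : 'I_n -> nat) : comb c 0 = 0.
Proof. by rewrite /= big1 // => j _; rewrite (beta00 hreal) mulr0. Qed.

Lemma root_spaceP (c : 'I_n -> nat) :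
  root_space iota (avmap (comb c : h0 -> R^o)) = avset (weight_space br i' (comb c)).
Proof. exact/root_spaceE/comb0. Qed.

Lemma root_spaceN (c : 'I_n -> nat) :
  root_space iota (- avmap (comb c : h0 -> R^o))
  = avset (weight_space br i' (fun h => - comb c h)).
Proof.
by rewrite avmapN; apply: root_spaceE; have /= -> := comb0 c; rewrite oppr0.
Qed.

Lemma root_sub b : Q1 b ->
  root_space iota b `<=` eta_p /\ root_space iota (- b) `<=` eta_m.
Proof.
move=> /Q1P [c [-> c0]]; rewrite root_spaceP root_spaceN eta_pE eta_mE.
split=> x hx k; first exact: (weight_in_eta_p bf lie pres c0).
exact: (weight_in_eta_m bf lie pres c0).
Qed.

Lemma fin_dim_avset (P : set eta) (m : nat) (v : 'I_m -> eta) :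
  submod P -> (forall k, P (v k)) ->
  (forall u, P u -> exists a : 'I_m -> R, u = \sum_k a k *: v k) ->
  fin_dimA (avset (r := r) P).
Proof.
move=> hP Pv span; split; first exact: AVsub_avset.
exists m, (fun k => real0 r (v k)); split=> [k|x Px]; first exact/avset_real0.
have /choice [a ha] : forall k, exists a : 'I_m -> R, x k = \sum_l a l *: v l.
  by move=> k; apply: span.
exists (fun l => [ffun k => a k l]); apply/ffunP => k; rewrite sum_ffunE ha.
by apply: eq_bigr => l _; rewrite lact_real0 // !ffunE.
Qed.

Lemma root_fin_dim b : Q1 b ->
  fin_dimA (root_space iota b) /\ fin_dimA (root_space iota (- b)).
Proof.
move=> /Q1P [c [-> c0]]; rewrite root_spaceP root_spaceN.
have [m [v [Pv sv]]] := weight_finite bf lie pres c0.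
have [m' [v' [Pv' sv']]] := weight_finiteN bf lie pres c0.
by split; apply: fin_dim_avset; do ?[exact: Pv|exact: sv|exact: Pv'|exact: sv'];
  apply: weight_space_submod.
Qed.

End EtaStructure.

(** * The root decomposition and the maximal ideal over A_r *)

Section EtaRoots.
Variables (R : realType) (r : nat) (hr : r = 2%N \/ r = 3%N).
Variables (n : nat) (A : 'M[CD r R]_n) (h0 : vectType R).
Variables (beta : 'I_n -> AV r h0 -> CD r R) (gamma : 'I_n -> AV r h0).
Hypotheses (hreal : realization A beta gamma) (hgamma : forall j, zero_part (gamma j)).
Variables (eta : lieA R r) (e f : 'I_n -> AV r eta) (iota : AV r h0 -> AV r eta).
Hypothesis heta : is_eta beta gamma e f iota.

Local Notation eta_p := (lie_gen (range e)).
Local Notation eta_m := (lie_gen (range f)).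
Local Notation Q1 := (Qplus beta `\ 0).
Local Notation B0 := (beta0 beta).
Local Notation br := (@rbr R r eta).
Local Notation e' := (e0 e).
Local Notation f' := (f0 f).
Local Notation i' := (i0 iota).
Local Notation comb c := (fun h => \sum_j (c j)%:R * B0 j h).
Local Notation functional := (AV r h0 -> CD r R).

Let sc := er_scal (proj1 heta).
Let lie : is_lie br := rbr_lie eta.
Let pres := real_presented hr hreal hgamma heta.
Let bl := beta0_lin hreal.
Let bf := beta0_free hr hreal.
Let hs := @h0_separated R h0.

Lemma rwt_Q1 p : Q1 (avmap (rwt B0 p : h0 -> R^o)).
Proof.
split.
  exists (fun j => count_mem j (rcons p.1 p.2)).
  by rewrite rwt1 (QplusE hr hreal erefl).
move=> E; apply: (rwt_neq0 bf (p := p)); apply/funext => v.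
have := congr1 (fun b : functional => b (real0 r v) (oz r)) E.
rewrite ffunE real0_oz => ->.
by rewrite -[LHS]/((0 : CD r R) (oz r)) ffunE.
Qed.

Lemma root_AVsub b : Q1 b ->
  AVsub (root_space iota b) /\ AVsub (root_space iota (- b)).
Proof.
move=> /(Q1P hr hreal) [c [-> _]].
rewrite (root_spaceP hr hreal heta) (root_spaceN hr hreal heta).
by split; apply: (AVsub_avset hr); apply: (weight_space_submod lie).
Qed.

(** Roots may repeat in the lists, so that sums are handled by concatenation; equal roots are merged
    in [eta_root_decomposition]. *)
Definition root_sum (x : AV r eta) : Prop :=
  exists (lm lp : seq (functional * AV r eta)) h,
  [/\ forall p, p \in lm -> Q1 p.1 /\ root_space iota (- p.1) p.2,
      forall p, p \in lp -> Q1 p.1 /\ root_space iota p.1 p.2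
    & x = \sum_(p <- lm) p.2 + iota h + \sum_(p <- lp) p.2].

Lemma root_sum_pure k u : root_sum (pure k u).
Proof.
have [lm [lp [h ->]]] := triangular_lists lie pres u.
exists [seq (avmap (rwt B0 p.2 : h0 -> R^o), pure k (p.1 *: rnorm br f' p.2)) | p <- lm].
exists [seq (avmap (rwt B0 p.2 : h0 -> R^o), pure k (p.1 *: rnorm br e' p.2)) | p <- lp].
exists (pure k h); split.
- move=> _ /mapP [p _ ->]; split; first exact: rwt_Q1.
  rewrite /= rwt1 (root_spaceN hr hreal heta).
  have hw := weight_space_submod lie i' (fun h =>
    - \sum_j (count_mem j (rcons p.2.1 p.2.2))%:R * B0 j h).
  move=> l; rewrite ffunE; case: ifP => _; last by case: hw.
  apply: (submodZ _ hw).
  have := rnorm_weight lie (weight_f (pr_rel pres)) p.2.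
  by rewrite rwtN; congr (weight_space _ _ _ _); apply/funext => v; rewrite -sumrN;
    apply: eq_bigr => j _; rewrite mulNr.
- move=> _ /mapP [p _ ->]; split; first exact: rwt_Q1.
  rewrite /= rwt1 (root_spaceP hr hreal heta).
  have hw := weight_space_submod lie i' (fun h =>
    \sum_j (count_mem j (rcons p.2.1 p.2.2))%:R * B0 j h).
  move=> l; rewrite ffunE; case: ifP => _; last by case: hw.
  apply: (submodZ _ hw).
  by have := rnorm_weight lie (weight_e (pr_rel pres)) p.2; rewrite rwt1.
rewrite !big_map /= !pureD; congr (_ + _ + _).
- by rewrite (big_morph (pure k) (@pureD _ _ _ k) (_ : pure k 0 = 0)) // -(scale0r
  (0 : eta)) pureZ scale0r.
- rewrite {2}(iotaE hr heta) avmap_pure //; exact: (i00 hr heta).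
- by rewrite (big_morph (pure k) (@pureD _ _ _ k) (_ : pure k 0 = 0)) // -(scale0r
  (0 : eta)) pureZ scale0r.
Qed.

Lemma root_sumT x : root_sum x.
Proof.
have iD : iota 0 = 0 by rewrite (iotaE hr heta); apply/ffunP => k; rewrite !ffunE (i00 hr heta).
have iA h h' : iota (h + h') = iota h + iota h'.
  by case: (er_h (proj1 heta)) => + _ _ _; apply.
rewrite (AV_sum_pure x); apply: (big_ind root_sum).
- by exists [::], [::], 0; rewrite !big_nil iD !addr0.
- move=> a b [lm [lp [h [hm hp ->]]]] [lm' [lp' [h' [hm' hp' ->]]]].
  exists (lm ++ lm'), (lp ++ lp'), (h + h'); split.
  + by move=> p; rewrite mem_cat => /orP[/hm|/hm'].
  + by move=> p; rewrite mem_cat => /orP[/hp|/hp'].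
  rewrite !big_cat /= iA [LHS]addrACA; congr (_ + _).
  by rewrite [LHS]addrACA.
by move=> k _; apply: root_sum_pure.
Qed.

Lemma eta_root_decomposition (x : AV r eta) :
  exists (s : seq functional) (um up : functional -> AV r eta) (h : AV r h0),
  [/\ uniq s, (forall b, b \in s -> Q1 b),
      (forall b, b \in s -> root_space iota (- b) (um b)),
      (forall b, b \in s -> root_space iota b (up b))
    & x = \sum_(b <- s) um b + iota h + \sum_(b <- s) up b].
Proof.
have [lm [lp [h [hm hp ->]]]] := root_sumT x.
(* One list serves both signs; a root occurring on one side only gets the empty sum on the other. *)
pose s := undup (map fst (lm ++ lp)).
have sQ b : b \in s -> Q1 b.
  rewrite mem_undup => /mapP [p + ->]; rewrite mem_cat.
  by move=> /orP[/hm[]|/hp[]].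
exists s, (fun b => \sum_(p <- lm | p.1 == b) p.2).
exists (fun b => \sum_(p <- lp | p.1 == b) p.2), h; split=> //.
- exact: undup_uniq.
- move=> b /sQ /root_AVsub [_ hb]; rewrite big_seq_cond; apply: AVsub_sum => //.
  by move=> p /andP[/hm [_ hw] /eqP <-].
- move=> b /sQ /root_AVsub [hb _]; rewrite big_seq_cond; apply: AVsub_sum => //.
  by move=> p /andP[/hp [_ hw] /eqP <-].
rewrite -!sum_by_fst ?undup_uniq // => p pl; rewrite mem_undup map_f //.
  by rewrite mem_cat pl orbT.
by rewrite mem_cat pl.
Qed.

(** In each component this is the independence of real weights. [F] recovers the real weight of a
    functional; on [s] it is injective, and its values are neither 0 nor negatives of one
    another. *)
Lemma eta_root_direct (s : seq functional) (um up : functional -> AV r eta) (h : AV r h0) :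
  uniq s -> (forall b, b \in s -> Q1 b) ->
  (forall b, b \in s -> root_space iota (- b) (um b)) ->
  (forall b, b \in s -> root_space iota b (up b)) ->
  \sum_(b <- s) um b + iota h + \sum_(b <- s) up b = 0 ->
  h = 0 /\ (forall b, b \in s -> um b = 0 /\ up b = 0).
Proof.
move=> us sQ hum hup E.
pose F (b : functional) : h0 -> R := fun v => b (real0 r v) (oz r).
have FE (g : h0 -> R^o) : F (avmap g) = g.
  by apply/funext => v; rewrite /F ffunE real0_oz.
have FQ b : b \in s -> exists c : 'I_n -> nat,
    [/\ b = avmap (comb c : h0 -> R^o), F b = comb c & comb c <> (fun=> 0)].
  move=> /sQ /(Q1P hr hreal) [c [bE c0]]; exists c; split=> //.
  by rewrite bE FE.
have F_inj b b' : b \in s -> b' \in s -> (F b == F b') = (b == b').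
  move=> /FQ [c [-> -> _]] /FQ [c' [-> -> _]].
  by apply/eqP/eqP => [->|/(congr1 F)] //; rewrite !FE.
have F_neg b b' : b \in s -> b' \in s -> ((fun v => - F b v) == F b') = false.
  move=> /FQ [c [_ -> c0]] /FQ [c' [_ -> _]]; apply/eqP => H; apply: c0.
  apply/funext => v; apply: big1 => j _.
  have hc : forall v, \sum_j (c j + c' j)%:R * B0 j v = 0.
    move=> w; have /= H' := congr1 (fun g : h0 -> R => g w) H.
    rewrite (eq_bigr (fun j => (c j)%:R * B0 j w + (c' j)%:R * B0 j w)) => [|l _].
      by rewrite big_split /= -H' subrr.
    by rewrite natrD mulrDl.
  have /eqP := bf hc j; rewrite pnatr_eq0 addn_eq0 => /andP[/eqP -> _].
  by rewrite mul0r.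
have F0 b : b \in s -> (F b == (fun=> 0)) = false /\ ((fun v => - F b v) == (fun=> 0)) = false.
  move=> /FQ [c [_ -> c0]]; split; apply/eqP => // H; apply: c0; apply/funext => v.
  have /= := congr1 (fun g : h0 -> R => g v) H.
  by move/eqP; rewrite oppr_eq0 => /eqP.
have key k b1 :
    \sum_(b <- s | (fun v => - F b v) == b1) um b k
    + ((if (fun=> 0) == b1 then i' (h k) else 0)
    + \sum_(b <- s | F b == b1) up b k) = 0.
  pose l := [seq ((fun v => - F b v), um b k) | b <- s]
    ++ ((fun=> 0), i' (h k)) :: [seq (F b, up b k) | b <- s].
  have hl p : p \in l -> weight_space br i' p.1 p.2.
    rewrite mem_cat in_cons => /orP[|/orP[/eqP ->|]].
    - move=> /mapP [b bs ->]; have [c [bE -> _]] := FQ _ bs.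
      have := hum _ bs; rewrite [in root_space _ _]bE (root_spaceN hr hreal heta).
      exact.
    - exact: (weight_i pres).
    - move=> /mapP [b bs ->]; have [c [bE -> _]] := FQ _ bs.
      have := hup _ bs; rewrite [in root_space _ _]bE (root_spaceP hr hreal heta).
      exact.
  have := weights_sum lie (zero_submod eta) (zero_stable lie i') hl _ b1.
  rewrite /l !big_cat /= !big_cons !big_map /= => H.
  have -> : (if (fun=> 0) == b1 then i' (h k) else 0)
      + \sum_(b <- s | F b == b1) up b k
    = if (fun=> 0) == b1 then i' (h k) + \sum_(b <- s | F b == b1) up b k
      else \sum_(b <- s | F b == b1) up b k by case: ifP; rewrite ?add0r.
  apply: H.
  have := congr1 (fun x : AV r eta => x k) E.
  by rewrite !ffunE !sum_ffunE (iota_comp hr heta) addrA.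
have pick (X : functional -> AV r eta) k b : b \in s ->
    \sum_(b' <- s | F b' == F b) X b' k = X b k.
  move=> bs; rewrite big_seq_cond (eq_bigl (pred1 b)) => [|b'].
    by rewrite -big_filter filter_pred1_uniq // big_seq1.
  rewrite /=; case: (boolP (b' \in s)) => b's /=; first by rewrite F_inj.
  by apply/esym/negbTE; apply: contra b's => /eqP ->.
have none (X : functional -> AV r eta) (G : functional -> h0 -> R) k b1 :
    (forall b, b \in s -> (G b == b1) = false) ->
    \sum_(b <- s | G b == b1) X b k = 0.
  by move=> hG; rewrite big_seq_cond big_pred0 // => b'; case: (boolP (_ \in _)) => // /hG.
split.
  apply/ffunP => k; rewrite ffunE.
  apply: (i_inj bl hs lie pres).
  have := key k (fun=> 0); rewrite eqxx.
  rewrite (none um (fun b v => - F b v)) ?add0r => [|b /F0 []//].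
  by rewrite (none up F) ?addr0 // => b /F0 [].
move=> b bs; split; apply/ffunP => k; rewrite ffunE.
  have := key k (fun v => - F b v).
  rewrite (none up F) => [|b' b's]; last by rewrite eq_sym F_neg.
  rewrite [(fun=> 0) == _]eq_sym (proj2 (F0 _ bs)) !addr0 => <-.
  rewrite -[LHS]pick //; apply: eq_bigl => b'.
  apply/eqP/eqP => [->//|H]; apply/funext => v.
  by have /= := congr1 (fun g : h0 -> R => g v) H; move/oppr_inj.
have := key k (F b).
rewrite (none um (fun b v => - F b v)) => [|b' b's]; last exact: F_neg.
by rewrite [(fun=> 0) == _]eq_sym (proj1 (F0 _ bs)) !add0r pick.
Qed.

(** The real part of an ideal over A_r that meets [iota] trivially is a real ideal of the same kind,
    so it lies in the largest one; components carry the inclusion back. *)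
Lemma eta_maximal_ideal : exists tau : set (AV r eta),
  [/\ lie_ideal tau /\ tau `&` range iota = [set 0],
      forall I : set (AV r eta), lie_ideal I -> I `&` range iota = [set 0] ->
        tau `<=` I -> I = tau,
      lie_ideal (tau `&` eta_m) /\ lie_ideal (tau `&` eta_p),
      forall x, tau x <->
        exists y z, [/\ (tau `&` eta_m) y, (tau `&` eta_p) z & x = y + z]
    & (tau `&` eta_m) `&` (tau `&` eta_p) = [set 0]].
Proof.
have [tau [ht th tmax tsum]] := maximal_ideal bl bf hs lie pres.
have avI (P Q : set eta) : avset (r := r) P `&` avset Q = avset (P `&` Q).
  rewrite predeqE => x; split=> [[Px Qx] k|H]; first by split; [exact: Px|exact: Qx].
  by split=> k; case: (H k).
exists (avset tau); split.
- split; first exact: (lie_ideal_avset hr sc).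
  rewrite predeqE => x; split=> [[tx [h _ hx]]|->].
    apply/ffunP => k; rewrite ffunE -hx (iota_comp hr heta); apply: th.
    by rewrite -(iota_comp hr heta) hx.
  split; first by move=> k; rewrite ffunE; case: (proj1 ht).
  by exists 0 => //; apply/ffunP => k; rewrite (iota_comp hr heta) !ffunE (i00 hr heta).
- move=> I hI I0 tI; rewrite eqEsubset; split=> // x Ix k.
  apply: (tmax (fun u => I (real0 r u))).
  + exact: lie_ideal_real.
  + move=> h Ih; apply: (@real0_inj _ r); rewrite real00.
    have : (I `&` range iota) (real0 r (i' h)).
      by split=> //; exists (real0 r h) => //; rewrite (iota_real0 hr heta).
    by rewrite I0.
  exact: (AVsub_comp hr k (proj1 hI)).
- rewrite (eta_mE hr heta) (eta_pE hr heta) !avI.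
  split; apply: (lie_ideal_avset hr sc).
    exact: (ideal_eta_m bl bf hs lie pres).
  exact: (ideal_eta_p bl bf hs lie pres).
- rewrite (eta_mE hr heta) (eta_pE hr heta) !avI => x; split=> [tx|[y [z [ty tz ->]]] k].
    have /choice [t ht'] : forall k, exists t : eta * eta,
        [/\ (tau `&` lgen br (range f')) t.1, (tau `&` lgen br (range e')) t.2
          & x k = t.1 + t.2].
      by move=> k; have [y [z H]] := tsum _ (tx k); exists (y, z).
    exists [ffun k => (t k).1], [ffun k => (t k).2]; split.
    - by move=> k; rewrite ffunE; case: (ht' k).
    - by move=> k; rewrite ffunE; case: (ht' k).
    by apply/ffunP => k; rewrite !ffunE; case: (ht' k).
  rewrite ffunE; apply: (submodD (proj1 ht)).
    by case: (ty k).
  by case: (tz k).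
rewrite predeqE => x; split=> [[[_ xm] [_ xp]]|->].
  have [] := eta_direct hr hreal hgamma heta (xm := x) (h := 0) (xp := - x) xm.
  + move: xp; rewrite (eta_pE hr heta) => xp k; rewrite ffunE.
    exact: (submodN (eta_p_submod br e')).
  + suff -> : iota 0 = 0 by rewrite addr0 subrr.
    by apply/ffunP => k; rewrite (iota_comp hr heta) !ffunE (i00 hr heta).
  by [].
rewrite (eta_mE hr heta) (eta_pE hr heta).
have z k : (0 : AV r eta) k = 0 by rewrite ffunE.
by split; split=> k; rewrite z; [case: (proj1 ht)|case: (eta_m_submod br f')
  |case: (proj1 ht)|case: (eta_p_submod br e')].
Qed.

End EtaRoots.

Unset Implicit Arguments.

Theorem theorem5 (R : realType) (r : nat) (hr : r = 2%N \/ r = 3%N)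
  (n : nat) (A : 'M[CD r R]_n)
  (h0 : vectType R) (beta : 'I_n -> AV r h0 -> CD r R) (gamma : 'I_n -> AV r h0)
  (hreal : realization A beta gamma)
  (* [e_j, f_j] = gamma_j with e_j, f_j in the real Lie algebra _0eta *)
  (hgamma : forall j, zero_part (gamma j))
  (eta : lieA R r) (e f : 'I_n -> AV r eta) (iota : AV r h0 -> AV r eta)
  (heta : is_eta beta gamma e f iota) :
  let eta_p : set (AV r eta) := lie_gen (range e) in
  let eta_m : set (AV r eta) := lie_gen (range f) in
  let Q1 : set (AV r h0 -> CD r R) := Qplus beta `\ 0 in
  [/\
    (* (1) *)
    (forall x : AV r eta, exists xm h xp,
       [/\ eta_m xm, eta_p xp & x = xm + iota h + xp]) /\
    (forall xm h xp, eta_m xm -> eta_p xp -> xm + iota h + xp = 0 ->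
       [/\ xm = 0, h = 0 & xp = 0]),
    (* (2) *)
    freely_generated eta_p e /\ freely_generated eta_m f,
    (* (3) *)
    exists! omega : AV r eta -> AV r eta,
      [/\ lie_hom omega, (forall x, omega (omega x) = x),
          (forall j, omega (e j) = - f j), (forall j, omega (f j) = - e j)
        & (forall h, omega (iota h) = - iota h)],
    (* (4) *)
    [/\ forall x : AV r eta,
          exists (s : seq (AV r h0 -> CD r R))
                 (um up : (AV r h0 -> CD r R) -> AV r eta) (h : AV r h0),
            [/\ uniq s, (forall b, b \in s -> Q1 b),
                (forall b, b \in s -> root_space iota (- b) (um b)),
                (forall b, b \in s -> root_space iota b (up b))
              & x = \sum_(b <- s) um b + iota h + \sum_(b <- s) up b],
        forall (s : seq (AV r h0 -> CD r R))
               (um up : (AV r h0 -> CD r R) -> AV r eta) (h : AV r h0),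
          uniq s -> (forall b, b \in s -> Q1 b) ->
          (forall b, b \in s -> root_space iota (- b) (um b)) ->
          (forall b, b \in s -> root_space iota b (up b)) ->
          \sum_(b <- s) um b + iota h + \sum_(b <- s) up b = 0 ->
          h = 0 /\ (forall b, b \in s -> um b = 0 /\ up b = 0),
        forall b, Q1 b ->
          fin_dimA (root_space iota b) /\ fin_dimA (root_space iota (- b))
      & forall b, Q1 b ->
          root_space iota b `<=` eta_p /\ root_space iota (- b) `<=` eta_m]
    (* (5) *)
  & exists tau : set (AV r eta),
      [/\ lie_ideal tau /\ tau `&` range iota = [set 0],
          forall I : set (AV r eta), lie_ideal I -> I `&` range iota = [set 0] ->
            tau `<=` I -> I = tau,
          lie_ideal (tau `&` eta_m) /\ lie_ideal (tau `&` eta_p),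
          forall x, tau x <->
            exists y z, [/\ (tau `&` eta_m) y, (tau `&` eta_p) z & x = y + z]
        & (tau `&` eta_m) `&` (tau `&` eta_p) = [set 0]]].
Proof.
move=> eta_p eta_m Q1; split.
- split; first exact: (eta_triangular hr hreal hgamma heta).
  move=> xm h xp; exact: (eta_direct hr hreal hgamma heta).
- split; first exact: (eta_p_free hr hreal hgamma heta).
  exact: (eta_m_free hr hreal hgamma heta).
- exact: (eta_involution hr hreal hgamma heta).
- split.
  + exact: (eta_root_decomposition hr hreal hgamma heta).
  + exact: (eta_root_direct hr hreal hgamma heta).
  + exact: (root_fin_dim hr hreal hgamma heta).
  + exact: (root_sub hr hreal hgamma heta).
- exact: (eta_maximal_ideal hr hreal hgamma heta).
Qed.
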